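(* If the $\{s\}$-consistency problem for the single tile $s=\{(0,0),(0,1),(1,0),(1,1)\}$ (the $2\times 2$ square) can be solved in polynomial time, then the $2$-atom consistency problem can be solved in polynomial time.
   Context: A tile is a finite subset of $\mathbb{Z}^2$ containing $(0,0)$, its center, which is its upper-left corner; coordinates are (row, column). For $(i,j)\in\mathbb{Z}^2$, $(i,j)+t=\{(i+i',j+j'):(i',j')\in t\}$. Fix a finite list of tiles $\mathcal{T}=(t_1,\dots,t_h)$; the index $k$ is the type of $t_k$ (different types may have the same shape and are then distinguished, like colors). Tiles may only be translated. A $\mathcal{T}$-tiling of the grid $\mathbb{Z}_n\times\mathbb{Z}_n=\{0,\dots,n-1\}^2$ is a finite set $T\subseteq \mathbb{Z}_n\times\mathbb{Z}_n\times\{1,\dots,h\}$ such that the sets $(i,j)+t_k$, $(i,j,k)\in T$, are pairwise disjoint and contained in the grid (the tiling need not cover the grid). Its projections are $r,c\in\mathbb{N}^{n\times h}$ with $r_{i,k}=|\{j:(i,j,k)\in T\}|$ and $c_{j,k}=|\{i:(i,j,k)\in T\}|$. The $\mathcal{T}$-consistency problem: given $n$ and $r,c\in\mathbb{N}^{n\times h}$, decide whether a $\mathcal{T}$-tiling of the $n\times n$ grid with projections $r,c$ exists. The $2$-atom consistency problem is the $\mathcal{T}$-consistency problem where $\mathcal{T}$ consists of two different types of the single cell $\{(0,0)\}$ (i.e. deciding whether the grid can be partially filled with cells of two colors having prescribed numbers of each color in every row and column). *)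

(* Defs.v *)
From Corelib Require Import BinNums.
From HB Require Import structures.
From mathcomp Require Import all_boot all_order all_algebra finmap.

Set Implicit Arguments.
Unset Strict Implicit.
Unset Printing Implicit Defensive.

Import GRing.Theory.

(** * Deterministic multi-tape Turing machines *)

Inductive move := MoveLeft | MoveStay | MoveRight.

(* A two-way infinite tape, whose blank is [None]: [tape_left] lists the cells
   strictly to the left of the head, nearest first, and [tape_right] the scanned
   cell and those to its right; all the cells not listed are blank. *)
Record tape (S : Type) := MkTape { tape_left : seq (option S);
                                   tape_right : seq (option S) }.

Section Tape.
Variable S : Type.
Implicit Type t : tape S.

Definition blank_tape : tape S := MkTape [::] [::].

Definition tape_of_word (w : seq S) : tape S := MkTape [::] (map Some w).

Definition tape_read t : option S := head None (tape_right t).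

Definition tape_write (s : option S) t : tape S :=
  MkTape (tape_left t) (s :: behead (tape_right t)).

Definition tape_move (m : move) t : tape S :=
  match m with
  | MoveLeft =>
      MkTape (behead (tape_left t)) (head None (tape_left t) :: tape_right t)
  | MoveStay => t
  | MoveRight =>
      MkTape (head None (tape_right t) :: tape_left t) (behead (tape_right t))
  end.

End Tape.

(* A machine with input alphabet [A] and [tm_tapes.+1] tapes. The symbols on the
   tapes are the blank, the letters of [A] and the letters of [tm_work]. The
   machine halts in a state [q] when [tm_verdict q] is [Some b]; it then accepts
   if [b = true] and rejects if [b = false]. *)
Record turing_machine (A : finType) := TuringMachine {
  tm_tapes : nat;
  tm_state : finType;
  tm_work : finType;
  tm_start : tm_state;
  tm_verdict : tm_state -> option bool;
  tm_trans : tm_state -> {ffun 'I_tm_tapes.+1 -> option (A + tm_work)} ->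
    tm_state * ('I_tm_tapes.+1 -> option (A + tm_work) * move)
}.

Section Run.
Variables (A : finType) (M : turing_machine A).

Definition tm_config : Type :=
  tm_state M * ('I_(tm_tapes M).+1 -> tape (A + tm_work M)).

Definition tm_init (w : seq A) : tm_config :=
  (tm_start M,
   fun i => if i == ord0 then tape_of_word (map inl w) else blank_tape _).

Definition tm_step (C : tm_config) : tm_config :=
  if tm_verdict C.1 is Some _ then C else
  let qa := tm_trans C.1 [ffun i => tape_read (C.2 i)] in
  (qa.1, fun i => tape_move (qa.2 i).2 (tape_write (qa.2 i).1 (C.2 i))).

(* [Some b] iff [M] halts on [w] after at most [t] steps with verdict [b]. *)
Definition tm_run (w : seq A) (t : nat) : option bool :=
  tm_verdict (iter t tm_step (tm_init w)).1.

End Run.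

(** * Decision problems and polynomial time *)

Record decision_problem (A : finType) := DecisionProblem {
  instance : Type;
  encode : instance -> seq A;
  yes_instance : instance -> Prop
}.

Definition solvable_in_polynomial_time (A : finType) (P : decision_problem A) :=
  exists (M : turing_machine A) (p : {poly nat}), forall x : instance P,
    exists2 b : bool,
      tm_run M (encode x) p.[size (encode x)]%R = Some b &
      (b <-> yes_instance x).

(** * Tiles, tilings and the consistency problem *)

(* A cell is a pair (row, column). *)
Record tile := MkTile {
  tile_cells : {fset int * int};
  tile_center : (0, 0)%R \in tile_cells
}.

Definition translate (p : int * int) (t : tile) : {fset int * int} :=
  [fset (p.1 + q.1, p.2 + q.2)%R | q in tile_cells t]%fset.

Definition in_grid (n : nat) (p : int * int) : bool :=
  ((0 <= p.1 < Posz n) && (0 <= p.2 < Posz n))%R.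

Section Tilings.
Variables (h : nat) (ts : h.-tuple tile) (n : nat).
Implicit Type T : {set 'I_n * 'I_n * 'I_h}.

Definition placed (x : 'I_n * 'I_n * 'I_h) : {fset int * int} :=
  translate (Posz x.1.1, Posz x.1.2) (tnth ts x.2).

Definition is_tiling T : Prop :=
  (forall x, x \in T -> forall p, p \in placed x -> in_grid n p) /\
  (forall x y, x \in T -> y \in T -> x != y ->
     [disjoint placed x & placed y]%fset).

Definition row_projection T : 'M[nat]_(n, h) :=
  \matrix_(i, k) #|[set j : 'I_n | (i, j, k) \in T]|.

Definition col_projection T : 'M[nat]_(n, h) :=
  \matrix_(j, k) #|[set i : 'I_n | (i, j, k) \in T]|.

End Tilings.

Record projections (h : nat) := Projections {
  grid_size : nat;
  proj_rows : 'M[nat]_(grid_size, h);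
  proj_cols : 'M[nat]_(grid_size, h)
}.

Definition consistent (h : nat) (ts : h.-tuple tile) (x : projections h) : Prop :=
  exists T : {set 'I_(grid_size x) * 'I_(grid_size x) * 'I_h},
    [/\ is_tiling ts T, row_projection T = proj_rows x
      & col_projection T = proj_cols x].

(* Binary digits, least significant first; 0 has no digits. *)
Fixpoint bits_of_pos (p : positive) : seq bool :=
  match p with
  | xH => [:: true]
  | xO q => false :: bits_of_pos q
  | xI q => true :: bits_of_pos q
  end.

Definition bits_of_nat (m : nat) : seq bool :=
  if bin_of_nat m is Npos p then bits_of_pos p else [::].

(* Words over the digits [Some b] and the end-of-number marker [None]. *)
Definition encode_nats (s : seq nat) : seq (option bool) :=
  flatten [seq rcons (map Some (bits_of_nat m)) None | m <- s].

Definition entries (m h : nat) (B : 'M[nat]_(m, h)) : seq nat :=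
  [seq B i k | i <- enum 'I_m, k <- enum 'I_h].

Definition encode_projections (h : nat) (x : projections h) : seq (option bool) :=
  encode_nats (grid_size x :: entries (proj_rows x) ++ entries (proj_cols x)).

Definition consistency_problem (h : nat) (ts : h.-tuple tile) :
    decision_problem (option bool) :=
  DecisionProblem (@encode_projections h) (consistent ts).

Definition square_cells : {fset int * int} :=
  [fset (0, 0); (0, 1); (1, 0); (1, 1)]%R%fset.

Fact square_center : (0, 0)%R \in square_cells.
Proof. by rewrite !inE. Qed.

Definition square : tile := MkTile square_center.

Definition atom_cells : {fset int * int} := [fset (0, 0)]%R%fset.

Fact atom_center : (0, 0)%R \in atom_cells.
Proof. by rewrite !inE. Qed.

Definition atom : tile := MkTile atom_center.

Definition square_consistency := consistency_problem [tuple square].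

Definition two_atom_consistency := consistency_problem [tuple atom; atom].

(* Main.v *)
From Corelib Require Import BinNums.
Require Import Defs.
From mathcomp Require Import all_boot all_order all_algebra finmap.
From mathcomp Require Import zify.

(** Every cell of the two-colour grid becomes a 6x6 block in which the projections
    allow corners of squares only in rows 0-2 and columns 0-4. Give a corner in
    row [p] and column [q] of its block the weight [(0,4,0)_p + (2,5,4,5,2)_q]. A
    packing of one block weighs at most 20, with equality for exactly three
    packings, which encode the colours 0 and 1 and the empty cell. The total
    weight is a linear function of the projections. If [C] and [C'] are the
    numbers of cells of colour 1 according to the rows and to the columns, it is
    [20 n^2 + 8 (C - C')], so once [C' <= C] has been checked every block is
    extremal; the colour counts are then recovered by solving a linear system.
    The instance is computed by a program on stacks: a Turing machine tape is a
    stack up to trailing blanks, the output is pushed from its last letter to its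
    first, and counters are unary because entries larger than [n] make the
    instance inconsistent and [n] is at most the length of the input. *)

(** Projections constrain a packing only through sums over whole lines, so the content of a block
    cannot be prescribed locally. The weights act as a dual certificate: a row term plus a column
    term can be evaluated from the projections alone, and a bound valid for every block and attained
    on average is attained in every block. The totals of colour 0 over the rows and over the columns
    need no test: the pattern of colour 0 has three squares and the other two have four, so counting
    the squares both ways makes these totals equal. Colour 1 and the empty cell both use four
    squares, which is why [C] and [C'] have to be compared. A square with its corner in column 4 of
    a block reaches column 5, so six columns keep neighbouring blocks disjoint. Vertically the
    patterns cover four rows, padded to six because the grid has to be square. *)

Set Implicit Arguments.
Unset Strict Implicit.
Unset Printing Implicit Defensive.

(** * Stack programs and their compilation *)

Inductive prog (A : Type) :=
  | Push of nat & A
  | Pop of nat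
  | Seq of prog A & prog A
  | If of nat & (option A -> bool) & prog A & prog A
  | While of nat & (option A -> bool) & prog A.
Arguments Pop {A} _.

Section StackPrograms.
Variable A : Type.
Implicit Types (p q : prog A) (s : seq (seq A)) (f : option A -> bool).

Definition stack s i : seq A := nth [::] s i.
Definition set_stack s i (v : seq A) := set_nth [::] s i v.

(** The times are the exact step counts of the compiled machine: a push costs 2 because the head
    moves to a fresh cell before writing, every test costs 1, and sequencing is free. *)
Inductive exec : prog A -> nat -> seq (seq A) -> seq (seq A) -> Prop :=
  | ExecPush i a s : exec (Push i a) 2 s (set_stack s i (a :: stack s i))
  | ExecPop i s : exec (Pop i) 1 s (set_stack s i (behead (stack s i)))
  | ExecSeq p q t1 t2 s1 s2 s3 : exec p t1 s1 s2 -> exec q t2 s2 s3 ->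
      exec (Seq p q) (t1 + t2) s1 s3
  | ExecIfTrue i f p q t s1 s2 : f (ohead (stack s1 i)) -> exec p t s1 s2 ->
      exec (If i f p q) t.+1 s1 s2
  | ExecIfFalse i f p q t s1 s2 : ~~ f (ohead (stack s1 i)) -> exec q t s1 s2 ->
      exec (If i f p q) t.+1 s1 s2
  | ExecWhileTrue i f p t1 t2 s1 s2 s3 : f (ohead (stack s1 i)) ->
      exec p t1 s1 s2 -> exec (While i f p) t2 s2 s3 ->
      exec (While i f p) (t1 + t2).+1 s1 s3
  | ExecWhileFalse i f p s : ~~ f (ohead (stack s i)) ->
      exec (While i f p) 1 s s.

Fixpoint uses_stacks_below (k : nat) p : bool :=
  match p with
  | Push i _ | Pop i => i < k
  | Seq p q => uses_stacks_below k p && uses_stacks_below k q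
  | If i _ p q => [&& i < k, uses_stacks_below k p & uses_stacks_below k q]
  | While i _ p => (i < k) && uses_stacks_below k p
  end.

Lemma uses_stacks_below_leq k k' p : k <= k' ->
  uses_stacks_below k p -> uses_stacks_below k' p.
Proof.
move=> le_k; have lt i : i < k -> i < k' by move=> /leq_trans; apply.
elim: p => /= [i a /lt|i /lt|p1 IH1 p2 IH2|i f p1 IH1 p2 IH2|i f p1 IH1] //.
- by case/andP=> /IH1-> /IH2->.
- by case/and3P=> /lt-> /IH1-> /IH2->.
- by case/andP=> /lt-> /IH1->.
Qed.

Lemma size_set_stack s i v k :
  size s = k -> i < k -> size (set_stack s i v) = k.
Proof. by move=> <- lt_ik; rewrite size_set_nth; apply/maxn_idPr. Qed.

(** [set_nth] lengthens a list when the index is out of range. Excluding this guarantees that the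
    tapes after the last stack are still blank when the next machine starts. *)
Lemma exec_size p t s s' k : exec p t s s' -> uses_stacks_below k p ->
  size s = k -> size s' = k.
Proof.
move=> E; elim: {p t s s'}E => /=.
- by move=> i a s lt_ik sz; exact: size_set_stack.
- by move=> i s lt_ik sz; exact: size_set_stack.
- by move=> p q t1 t2 s1 s2 s3 _ IH1 _ IH2 /andP[b1 b2] /(IH1 b1)/(IH2 b2).
- by move=> i f p q t s1 s2 _ _ IH /and3P[_ b1 _] /(IH b1).
- by move=> i f p q t s1 s2 _ _ IH /and3P[_ _ b2] /(IH b2).
- by move=> i f p t1 t2 s1 s2 s3 _ _ IH1 _ IH2 b /(IH1 (proj2 (andP b)))/(IH2 b).
- by [].
Qed.

Definition total_size s := sumn (map size s).

Lemma total_size_set_stack s i v :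
  total_size (set_stack s i v) + size (stack s i) = total_size s + size v.
Proof.
rewrite /total_size /stack /set_stack; elim: s i => [|x s IHs] [|i] /=.
- by lia.
- suff -> : sumn [seq size j | j <- ncons i [::] [:: v]] = size v by lia.
  by elim: i => [|i IHi] /=; lia.
- by lia.
- by have := IHs i; lia.
Qed.

(** Only a push adds a letter, so the running time also bounds the length of the output. *)
Lemma exec_total_size p t s s' : exec p t s s' ->
  total_size s' <= total_size s + t.
Proof.
elim=> {p t s s'} /=; try lia.
- by move=> i a s; have := total_size_set_stack s i (a :: stack s i) => /=; lia.
- move=> i s; have := total_size_set_stack s i (behead (stack s i)).
  by rewrite size_behead; lia.
Qed.

Lemma size_stack_le s i : size (stack s i) <= total_size s.
Proof.
rewrite /stack /total_size; elim: s i => [|x s IHs] [|i] //=; first by lia.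
by have := IHs i; lia.
Qed.

End StackPrograms.

(** * Tapes up to trailing blanks *)

Definition tape_eq (S : Type) (t u : tape S) : Prop :=
  (forall n, nth None (tape_left t) n = nth None (tape_left u) n) /\
  (forall n, nth None (tape_right t) n = nth None (tape_right u) n).

Section TapeEq.
Variable S : Type.
Implicit Types t u : tape S.

Lemma tape_eq_refl t : tape_eq t t. Proof. by []. Qed.

Lemma tape_read_eq t u : tape_eq t u -> tape_read t = tape_read u.
Proof. by case=> _ /(_ 0); rewrite !nth0. Qed.

Lemma tape_write_eq x t u :
  tape_eq t u -> tape_eq (tape_write x t) (tape_write x u).
Proof.
move=> [el er]; split=> // -[|n] //=.
by rewrite !nth_behead.
Qed.

Lemma tape_move_eq m t u : tape_eq t u -> tape_eq (tape_move m t) (tape_move m u).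
Proof.
case: m => //= -[el er].
- split=> [n|[|n]] //=; first by rewrite !nth_behead.
  by rewrite -!nth0 el.
- split=> [[|n]|n] //=; last by rewrite !nth_behead.
  by rewrite -!nth0 er.
Qed.

Lemma tape_rewrite_eq t u : tape_eq t u -> tape_eq (tape_write (tape_read t) t) u.
Proof.
move=> [el er]; split=> // n; rewrite -er /tape_read /=.
by case: n (tape_right t) => [|n] [|y r] //=; rewrite nth_nil.
Qed.

(** The popped cell is blanked before the head leaves it, so the left half stays blank and the tape
    represents a stack again. *)
Lemma tape_pop_eq t w : tape_eq t (tape_of_word w) ->
  tape_eq (tape_move MoveRight (tape_write None t)) (tape_of_word (behead w)).
Proof.
move=> [el er]; split=> [[|n]|n] //=; first by rewrite el nth_nil.
by rewrite nth_behead er /= -nth_behead behead_map.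
Qed.

Lemma tape_push_eq x t w : tape_eq t (tape_of_word w) ->
  tape_eq (tape_write (Some x)
             (tape_move MoveLeft (tape_write (tape_read t) t)))
          (tape_of_word (x :: w)).
Proof.
move=> et; have [el er] := tape_rewrite_eq et.
by split=> [n|[|n]] //=; rewrite nth_behead (el n.+1) /= nth_nil.
Qed.

End TapeEq.

(** * Compilation of stack programs to machine transitions *)

Inductive action (A : Type) :=
  | Idle | MakeRoom of nat | PutTop of nat & A | DropTop of nat.
Arguments Idle {A}.
Arguments MakeRoom {A} _.
Arguments DropTop {A} _.

Section Compilation.
Variables (A W : finType) (k : nat).

Local Notation symbol := (A + W)%type.
Local Notation tapes := ('I_k.+1 -> tape symbol).
Implicit Types (p q : prog A) (s : seq (seq A)) (tp : tapes).

Definition input_letter (x : option symbol) : option A :=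
  if x is Some (inl a) then Some a else None.

(** Program points form a finite type so that they can serve as machine states. The two points of a
    push lie before and after making room; [None] in [If] and [While] is the point where the test is
    made. *)
Fixpoint label p : finType :=
  match p with
  | Push _ _ => bool : finType
  | Pop _ => unit : finType
  | Seq p q => (label p + label q)%type : finType
  | If _ _ p q => option (label p + label q) : finType
  | While _ _ p => option (label p) : finType
  end.

Fixpoint entry p : label p :=
  match p return label p with
  | Push _ _ => false
  | Pop _ => tt
  | Seq p q => inl (entry p)
  | If _ _ p q => None
  | While _ _ p => None
  end.

(* The first component is the next label, or [None] on exit. *)
Fixpoint next p (rd : {ffun 'I_k.+1 -> option symbol}) :
    label p -> option (label p) * action A :=
  match p return label p -> option (label p) * action A with
  | Push i a => fun l =>
      if l then (None, PutTop i a) else (Some true, MakeRoom i)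
  | Pop i => fun _ => (None, DropTop i)
  | Seq p q => fun l =>
      match l with
      | inl l1 => let: (o, a) := next rd l1 in
          (Some (if o is Some l2 then inl l2 else inr (entry q)), a)
      | inr l1 => let: (o, a) := next rd l1 in (omap inr o, a)
      end
  | If i f p q => fun l =>
      match l with
      | None => (Some (Some (if f (input_letter (rd (inord i)))
                             then inl (entry p) else inr (entry q))), Idle)
      | Some (inl l1) => let: (o, a) := next rd l1 in
          (omap (fun l2 => Some (inl l2)) o, a)
      | Some (inr l1) => let: (o, a) := next rd l1 in
          (omap (fun l2 => Some (inr l2)) o, a)
      end
  | While i f p => fun l =>
      match l with
      | None => (if f (input_letter (rd (inord i)))
                 then Some (Some (entry p)) else None, Idle)
      | Some l1 => let: (o, a) := next rd l1 in (Some o, a)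
      end
  end.

Definition effect (a : action A) (j : nat) (x : option symbol) :
    option symbol * move :=
  match a with
  | Idle => (x, MoveStay)
  | MakeRoom i => (x, if j == i then MoveLeft else MoveStay)
  | PutTop i a => (if j == i then Some (inl a) else x, MoveStay)
  | DropTop i => if j == i then (None, MoveRight) else (x, MoveStay)
  end.

Definition reads tp : {ffun 'I_k.+1 -> option symbol} :=
  [ffun i => tape_read (tp i)].

Definition update tp (e : 'I_k.+1 -> option symbol * move) : tapes :=
  fun j => tape_move (e j).2 (tape_write (e j).1 (tp j)).

Definition perform (a : action A) tp : tapes :=
  update tp (fun j => effect a j (reads tp j)).

Inductive exits p : nat -> label p -> tapes -> tapes -> Prop :=
  | ExitsNow l a tp : next (reads tp) l = (None, a) ->
      exits 1 l tp (perform a tp)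
  | ExitsLater t l l' a tp tp' : next (reads tp) l = (Some l', a) ->
      exits t l' (perform a tp) tp' -> exits t.+1 l tp tp'.

Lemma exits_seq_right p q t l tp tp' :
  exits t l tp tp' -> @exits (Seq p q) t (inr l) tp tp'.
Proof.
elim=> {t l tp tp'} [l a tp e|t l l' a tp tp' e _ IH].
  by apply: ExitsNow; rewrite /= e.
by apply: (@ExitsLater (Seq p q) _ _ (inr l') a); rewrite //= e.
Qed.

Lemma exits_seq p q t1 t2 l tp1 tp2 tp3 :
  exits t1 l tp1 tp2 -> exits t2 (entry q) tp2 tp3 ->
  @exits (Seq p q) (t1 + t2) (inl l) tp1 tp3.
Proof.
move=> E Eq; elim: E Eq => {t1 l tp1 tp2} [l a tp e|t l l' a tp tp' e _ IH] Eq.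
  apply: (@ExitsLater (Seq p q) _ _ (inr (entry q)) a); first by rewrite /= e.
  exact: exits_seq_right.
rewrite addSn; apply: (@ExitsLater (Seq p q) _ _ (inl l') a); last exact: IH.
by rewrite /= e.
Qed.

Lemma exits_if_true i f p q t l tp tp' :
  exits t l tp tp' -> @exits (If i f p q) t (Some (inl l)) tp tp'.
Proof.
elim=> {t l tp tp'} [l a tp e|t l l' a tp tp' e _ IH].
  by apply: ExitsNow; rewrite /= e.
by apply: (@ExitsLater (If i f p q) _ _ (Some (inl l')) a); rewrite //= e.
Qed.

Lemma exits_if_false i f p q t l tp tp' :
  exits t l tp tp' -> @exits (If i f p q) t (Some (inr l)) tp tp'.
Proof.
elim=> {t l tp tp'} [l a tp e|t l l' a tp tp' e _ IH].
  by apply: ExitsNow; rewrite /= e.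
by apply: (@ExitsLater (If i f p q) _ _ (Some (inr l')) a); rewrite //= e.
Qed.

(** [next] redirects an exit of the body to the label [None], where the loop makes its test
    again. *)
Lemma exits_while i f p t1 t2 l tp1 tp2 tp3 :
  exits t1 l tp1 tp2 -> @exits (While i f p) t2 None tp2 tp3 ->
  @exits (While i f p) (t1 + t2) (Some l) tp1 tp3.
Proof.
move=> E Eq; elim: E Eq => {t1 l tp1 tp2} [l a tp e|t l l' a tp tp' e _ IH] Eq.
  by apply: (@ExitsLater (While i f p) _ _ None a); rewrite //= e.
rewrite addSn; apply: (@ExitsLater (While i f p) _ _ (Some l') a); last exact: IH.
by rewrite /= e.
Qed.

(** Since [stack] defaults to the empty list, every tape without a stack is required to be blank. *)
Definition represents tp s : Prop :=
  forall j, tape_eq (tp j) (tape_of_word (map inl (stack s j))).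

Lemma represents_letter tp s i : i < k.+1 -> represents tp s ->
  input_letter (reads tp (inord i)) = ohead (stack s i).
Proof.
move=> lt_ik /(_ (inord i)) /tape_read_eq; rewrite inordK // ffunE => ->.
by case: (stack s i).
Qed.

Lemma represents_idle tp s : represents tp s -> represents (perform Idle tp) s.
Proof. by move=> rp j; rewrite /perform /update ffunE; apply: tape_rewrite_eq. Qed.

Lemma stack_set_stack s i v j :
  stack (set_stack s i v) j = if j == i then v else stack s j.
Proof. by rewrite /stack nth_set_nth. Qed.

Lemma represents_pop tp s i : represents tp s ->
  represents (perform (DropTop i) tp) (set_stack s i (behead (stack s i))).
Proof.
move=> rp j; rewrite stack_set_stack /perform /update ffunE /=.
case: eqP => [<-|_] /=; last exact: tape_rewrite_eq.
by rewrite -behead_map; apply: tape_pop_eq.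
Qed.

Lemma represents_push tp s i a : represents tp s ->
  represents (perform (PutTop i a) (perform (MakeRoom i) tp))
             (set_stack s i (a :: stack s i)).
Proof.
move=> rp j; rewrite stack_set_stack /perform /update !ffunE /=.
case: eqP => [<-|_] /=; first exact: tape_push_eq.
by do 2!apply: tape_rewrite_eq.
Qed.

Lemma exec_exits p t s s' : exec p t s s' -> uses_stacks_below k.+1 p ->
  forall tp, represents tp s ->
  exists2 tp', represents tp' s' & exits t (entry p) tp tp'.
Proof.
move=> E; elim: {p t s s'}E => /=.
- move=> i a s lt_ik tp rp; eexists; first exact: represents_push rp.
  by apply: (@ExitsLater (Push i a) _ _ true (MakeRoom i)); last exact: ExitsNow.
- move=> i s lt_ik tp rp; eexists; first exact: represents_pop rp.
  exact: ExitsNow.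
- move=> p q t1 t2 s1 s2 s3 _ IH1 _ IH2 /andP[b1 b2] tp1 rp1.
  have [tp2 rp2 E1] := IH1 b1 _ rp1; have [tp3 rp3 E2] := IH2 b2 _ rp2.
  by exists tp3 => //; apply: exits_seq E1 E2.
- move=> i f p q t s1 s2 fi _ IH /and3P[lt_ik b1 _] tp rp.
  have [tp' rp' E] := IH b1 _ (represents_idle rp).
  exists tp' => //; apply: (@ExitsLater (If i f p q) _ _ (Some (inl (entry p))) Idle).
    by rewrite /= (represents_letter lt_ik rp) fi.
  exact: exits_if_true.
- move=> i f p q t s1 s2 fi _ IH /and3P[lt_ik _ b2] tp rp.
  have [tp' rp' E] := IH b2 _ (represents_idle rp).
  exists tp' => //; apply: (@ExitsLater (If i f p q) _ _ (Some (inr (entry q))) Idle).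
    by rewrite /= (represents_letter lt_ik rp) (negPf fi).
  exact: exits_if_false.
- move=> i f p t1 t2 s1 s2 s3 fi _ IH1 _ IH2 b tp1 rp1.
  case/andP: (b) => lt_ik bp.
  have [tp2 rp2 E1] := IH1 bp _ (represents_idle rp1).
  have [tp3 rp3 E2] := IH2 b _ rp2.
  exists tp3 => //; apply: (@ExitsLater (While i f p) _ _ (Some (entry p)) Idle).
    by rewrite /= (represents_letter lt_ik rp1) fi.
  exact: exits_while E1 E2.
- move=> i f p s fi /andP[lt_ik _] tp rp.
  eexists; first exact: represents_idle rp.
  by apply: ExitsNow; rewrite /= (represents_letter lt_ik rp) (negPf fi).
Qed.

End Compilation.

(** * A stack program followed by a Turing machine *)

Section Composition.
Variables (A : finType) (M : turing_machine A) (p : prog A) (k : nat).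

Local Notation m := (tm_tapes M).
Local Notation symbol := (A + tm_work M)%type.

Definition compose_trans (q : label p + tm_state M)
    (rd : {ffun 'I_(k + m.+1).+1 -> option symbol}) :
    (label p + tm_state M) * ('I_(k + m.+1).+1 -> option symbol * move) :=
  match q with
  | inl l => let oa := next rd l in
      (if oa.1 is Some l' then inl l' else inr (tm_start M),
       fun j : 'I_(k + m.+1).+1 => effect oa.2 j (rd j))
  | inr q => let qa := tm_trans q [ffun i => rd (rshift k.+1 i)] in
      (inr qa.1, fun j : 'I_(k + m.+1).+1 => match @split k.+1 m.+1 j with
                          | inl _ => (rd j, MoveStay)
                          | inr i => qa.2 i
                          end)
  end.

(* Runs [p] on the first [k.+2] tapes, and then [M] on all the tapes but the
   first [k.+1]: the last stack of [p] becomes the input tape of [M]. *)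
Definition compose : turing_machine A :=
  {| tm_tapes := k + m.+1;
     tm_state := (label p + tm_state M)%type;
     tm_work := tm_work M;
     tm_start := inl (entry p);
     tm_verdict := fun q => if q is inr q then tm_verdict q else None;
     tm_trans := compose_trans |}.

Lemma compose_exits t l tp tp' : @exits A _ _ p t l tp tp' ->
  iter t (@tm_step A compose) (inl l, tp) = (inr (tm_start M), tp').
Proof.
elim=> {t l tp tp'} [l a tp e|t l l' a tp tp' e _ IH].
  by rewrite /= /tm_step /= -/(reads tp) e.
by rewrite iterSr {2}/tm_step /= -/(reads tp) e /= -IH.
Qed.

(** The stack program delivers its output only up to trailing blanks. [M] cannot notice them, as it
    sees a tape only through [tape_read]. *)
Lemma compose_run t q (tp : 'I_(k + m.+1).+1 -> tape symbol) tpM :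
  (forall i, tape_eq (tp (rshift k.+1 i)) (tpM i)) ->
  tm_verdict (iter t (@tm_step A compose) (inr q, tp)).1 =
  tm_verdict (iter t (@tm_step A M) (q, tpM)).1.
Proof.
elim: t q tp tpM => [|t IH] q tp tpM etp //.
rewrite !iterSr {2 4}/tm_step /=; case: (tm_verdict q) => [b|]; first exact: IH.
set r1 := [ffun i => _ (rshift _ i)]; set r2 := [ffun i => _ (tpM i)].
have -> : r1 = r2 by apply/ffunP=> i; rewrite !ffunE; apply: tape_read_eq.
apply: IH => i; rewrite (unsplitK (inr i)).
by apply: tape_move_eq; apply: tape_write_eq.
Qed.

Lemma tm_run_halted (B : finType) (M' : turing_machine B) w t t' b :
  tm_run M' w t = Some b -> t <= t' -> tm_run M' w t' = Some b.
Proof.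
rewrite /tm_run => e /subnK <-; rewrite iterD.
elim: (t' - t) => [//|d IH] /=.
by rewrite {1}/tm_step IH.
Qed.

Lemma compose_correct w w' t s b t' :
  uses_stacks_below k.+2 p ->
  exec p t (w :: nseq k.+1 [::]) s -> stack s k.+1 = w' ->
  tm_run M w' t' = Some b -> tm_run compose w (t + t') = Some b.
Proof.
move=> bp E sw' run.
have bp' : uses_stacks_below (k + m.+1).+1 p.
  by apply: uses_stacks_below_leq bp; lia.
have rp0 : represents (tm_init compose w).2 (w :: nseq k.+1 [::]).
  case=> -[|j] lt_j; first exact: tape_eq_refl.
  rewrite [stack _ _](_ : _ = nth [::] (nseq k.+1 [::]) j) // nth_nseq if_same.
  exact: tape_eq_refl.
have [tp' rp' /compose_exits E'] := exec_exits E bp' rp0.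
rewrite -run /tm_run addnC iterD /tm_init /= E'; apply: compose_run => i.
(* Tape [k.+1] holds the output and is the input tape of [M]. Any later tape lies beyond all the
   stacks, hence is blank as [tm_init] demands. *)
have := rp' (rshift k.+1 i); case: eqP => [->|/eqP nz].
  by rewrite [nat_of_ord _]addn0 sw'.
have sz : size s = k.+2 by apply: exec_size E bp _; rewrite /= size_nseq.
rewrite [stack _ _]nth_default //; rewrite sz.
by move: nz; rewrite -val_eqE /=; lia.
Qed.

End Composition.

Lemma leq_horner (p : {poly nat}) (m n : nat) : m <= n -> p.[m]%R <= p.[n]%R.
Proof.
move=> le_mn; rewrite !horner_coef.
elim/big_ind2: _ => // [a b c d|i _]; first exact: leq_add.
by apply: leq_mul => //; elim: (i : nat) => // j IH; rewrite !GRing.exprS; apply: leq_mul.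
Qed.

Lemma polynomial_time_reduction (A : finType) (P Q : decision_problem A)
    (f : instance P -> instance Q) (p : prog A) (k : nat) (B : {poly nat}) :
  uses_stacks_below k.+2 p ->
  (forall x, yes_instance (f x) <-> yes_instance x) ->
  (forall x, exists t s,
     [/\ t <= B.[size (encode x)]%R,
         exec p t (encode x :: nseq k.+1 [::]) s
       & stack s k.+1 = encode (f x)]) ->
  solvable_in_polynomial_time Q -> solvable_in_polynomial_time P.
Proof.
move=> bp yesP runP [M [pM solves]].
(* The output of [p] is at most as long as its input plus its running time, so [M] starts on at most
   ['X + B] letters. *)
exists (compose M p k), (B + (pM \Po ('X + B)))%R => x.
have [t [s [le_tB E sO]]] := runP x.
have [b run yes] := solves (f x).
exists b; last by rewrite -yesP.
apply: tm_run_halted (compose_correct bp E sO run) _.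
rewrite hornerD; apply: leq_add => //; rewrite horner_comp hornerD hornerX.
apply: leq_horner; rewrite -sO (leq_trans (size_stack_le _ _)) //.
apply: leq_trans (exec_total_size E) _; rewrite /total_size /= map_nseq sumn_nseq.
by rewrite mul0n !addn0; move: le_tB; rewrite -(leq_add2l (size (encode x))).
Qed.

(** * From colourings to packings of squares *)

(** Extending functions from ordinals to [nat] lets blocks be addressed as [i * 6 + p] without
    carrying bound proofs. *)
Definition restrict_fun (n : nat) (T : Type) (d : T) (F : 'I_n -> T) (i : nat) : T :=
  if insub i is Some i' then F i' else d.

Lemma restrict_fun_ord n T (d : T) (F : 'I_n -> T) (i : 'I_n) :
  restrict_fun d F i = F i.
Proof. by rewrite /restrict_fun valK. Qed.

Lemma restrict_fun_out n T (d : T) (F : 'I_n -> T) (i : nat) :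
  n <= i -> restrict_fun d F i = d.
Proof. by move=> le_ni; rewrite /restrict_fun insubN // -leqNgt. Qed.

Lemma card_set_sum (T : finType) (P : pred T) : #|[set x | P x]| = \sum_x P x.
Proof.
by rewrite -sum1dep_card big_mkcond; apply: eq_bigr => x _; case: (P x).
Qed.

(** [S] marks upper-left corners: two squares are disjoint exactly when their corners differ by at
    least 2 in some coordinate. *)
Definition square_packing (N : nat) (S : nat -> nat -> bool) : Prop :=
  (forall u v, S u v -> u.+1 < N /\ v.+1 < N) /\
  (forall u v u' v', S u v -> S u' v' -> (u, v) != (u', v') ->
     [|| u.+1 < u', u'.+1 < u, v.+1 < v' | v'.+1 < v]).

Lemma mem_placed_square n (x : 'I_n * 'I_n * 'I_1) (c : int * int) :
  reflect (exists d e, [/\ d <= 1, e <= 1 & c = (Posz (x.1.1 + d), Posz (x.1.2 + e))])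
          (c \in placed [tuple square] x).
Proof.
rewrite /placed /translate (_ : tnth _ x.2 = square) ?(ord1 x.2) //.
apply: (iffP (imfsetP _ _ _ _)) => [[q /= sq ->]|[d [e [d1 e1 ->]]]].
  move: sq; rewrite !inE => /orP[/orP[/orP[]|]|] /eqP-> /=.
  - by exists 0, 0; rewrite !PoszD.
  - by exists 0, 1; rewrite !PoszD.
  - by exists 1, 0; rewrite !PoszD.
  - by exists 1, 1; rewrite !PoszD.
exists (Posz d, Posz e) => //=; rewrite !inE.
by case: d d1 => [|[|]] // _; case: e e1 => [|[|]].
Qed.

Lemma placed_square_cell n (x : 'I_n * 'I_n * 'I_1) (u v : nat) :
  x.1.1 <= u <= x.1.1.+1 -> x.1.2 <= v <= x.1.2.+1 ->
  (Posz u, Posz v) \in placed [tuple square] x.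
Proof.
move=> hu hv; apply/mem_placed_square; exists (u - x.1.1), (v - x.1.2).
by split; try congr (Posz _, Posz _); lia.
Qed.

Lemma mem_placed_atom n (x : 'I_n * 'I_n * 'I_2) (c : int * int) :
  (c \in placed [tuple atom; atom] x) = (c == (Posz x.1.1, Posz x.1.2)).
Proof.
rewrite /placed /translate (_ : tnth _ x.2 = atom); last by case: x.2 => -[|[|]].
apply/imfsetP/eqP => [[q /=]|->].
  by rewrite !inE => /eqP-> ->; rewrite /= !GRing.addr0.
by exists (0, 0)%R; rewrite ?inE //= !GRing.addr0.
Qed.

Lemma square_consistentP (x : projections 1) :
  let N := grid_size x in
  consistent [tuple square] x <-> exists S : nat -> nat -> bool,
    [/\ square_packing N S,
        forall u : 'I_N, \sum_(v < N) S u v = proj_rows x u ord0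
      & forall v : 'I_N, \sum_(u < N) S u v = proj_cols x v ord0].
Proof.
case: x => N R C /=; split=> [[T /= [[inT disT] <- <-]]|[S [[inS sepS] RS CS]]].
  pose S u v := restrict_fun false
    (fun i => restrict_fun false (fun j => (i, j, ord0) \in T) v) u.
  have SE (i j : 'I_N) : S i j = ((i, j, ord0) \in T).
    by rewrite /S restrict_fun_ord restrict_fun_ord.
  have S_ord u v : S u v -> exists i j : 'I_N, [/\ u = i, v = j & (i, j, ord0) \in T].
    case: (ltnP u N) => [lu|lu]; last by rewrite /S restrict_fun_out.
    case: (ltnP v N) => [lv|lv]; last first.
      by rewrite /S /restrict_fun; case: insubP => // i _ _; case: insubP => // j;
      rewrite ltnNge lv.
    by rewrite (SE (Ordinal lu) (Ordinal lv)) => ijT; exists (Ordinal lu), (Ordinal lv).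
  exists S; split.
  - split=> [u v /S_ord[i [j [-> -> ijT]]]|u v u' v'].
      have /= := inT _ ijT (Posz i.+1, Posz j.+1).
      rewrite /in_grid /= placed_square_cell //= ?leqnSn ?leqnn // => /(_ isT).
      by lia.
    move=> /S_ord[i [j [-> -> ijT]]] /S_ord[i' [j' [-> -> ijT']]] ne.
    apply: contraT => close.
    have ne' : (i, j, ord0 : 'I_1) != (i', j', ord0).
      by apply: contraNneq ne => -[-> ->].
    (* If the corners differ by at most 1 in both coordinates, the coordinatewise maximum is a cell
       of both squares. *)
    have /fdisjointP/(_ (Posz (maxn i i'), Posz (maxn j j'))) := disT _ _ ijT ijT' ne'.
    rewrite !placed_square_cell /=; lia.
  - by move=> u; rewrite mxE card_set_sum; apply: eq_bigr => v _; rewrite SE.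
  - by move=> v; rewrite mxE card_set_sum; apply: eq_bigr => u _; rewrite SE.
exists [set x : 'I_N * 'I_N * 'I_1 | S x.1.1 x.1.2]; split.
- split=> [[[i j] k]|[[i j] k] [[i' j'] k']]; rewrite !inE /=.
    move=> /inS/= [lti ltj] c /mem_placed_square[d [e [d1 e1 ->]]].
    by rewrite /in_grid /=; lia.
  move=> Sij Sij' ne; have /sepS : S i j by []. move=> /(_ _ _ Sij') sep.
  have {}sep : [|| i.+1 < i', i'.+1 < i, j.+1 < j' | j'.+1 < j].
    by apply: sep; apply: contraNneq ne => -[/val_inj-> /val_inj->]; rewrite (ord1 k) (ord1 k').
  apply/fdisjointP => c /mem_placed_square[d [e [d1 e1 ->]]].
  apply/negP => /mem_placed_square[d' [e' [d1' e1' []]]] /=; simpl in sep; lia.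
- apply/matrixP => i k; rewrite (ord1 k) mxE card_set_sum -RS.
  by apply: eq_bigr => v _; rewrite inE.
- apply/matrixP => j k; rewrite (ord1 k) mxE card_set_sum -CS.
  by apply: eq_bigr => v _; rewrite inE.
Qed.

(** Disjointness of atoms says that no cell carries both types, so a tiling is a partial colouring
    [g]; every value of [g] other than 0 and 1 stands for an empty cell. *)
Lemma two_atom_consistentP (x : projections 2) :
  let n := grid_size x in
  consistent [tuple atom; atom] x <-> exists g : nat -> nat -> nat,
    (forall (i : 'I_n) (k : 'I_2), \sum_(j < n) (g i j == k :> nat) = proj_rows x i k) /\
    (forall (j : 'I_n) (k : 'I_2), \sum_(i < n) (g i j == k :> nat) = proj_cols x j k).
Proof.
case: x => n r c /=; split=> [[T /= [[_ disT] <- <-]]|[g [rg cg]]].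
  pose g i j := restrict_fun 2 (fun i => restrict_fun 2 (fun j =>
    if (i, j, ord0) \in T then 0 else if (i, j, ord_max) \in T then 1 else 2) j) i.
  have gE (i j : 'I_n) (k : 'I_2) : (g i j == k :> nat) = ((i, j, k) \in T).
    rewrite /g !restrict_fun_ord.
    have [->|->] : k = ord0 \/ k = ord_max.
      by case: k => -[|[|]] // lt; [left|right]; apply: val_inj.
    - by case: ifP => // _; case: ifP.
    - case: ifP => [T0|_]; last by case: ifP.
      symmetry; apply/negP => T1.
      have ne : (i, j, ord0 : 'I_2) != (i, j, ord_max) by rewrite xpair_eqE andbC.
      have /fdisjointP := disT _ _ T0 T1 ne.
      by move=> /(_ (Posz i, Posz j)); rewrite !mem_placed_atom /= eqxx => /(_ isT).
  exists g; split=> i k; rewrite mxE card_set_sum;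
    by apply: eq_bigr => j _; rewrite gE.
exists [set x : 'I_n * 'I_n * 'I_2 | g x.1.1 x.1.2 == x.2]; split.
- split=> [[[i j] k] _ c0|[[i j] k] [[i' j'] k']].
    rewrite mem_placed_atom => /eqP->; have := ltn_ord i; have := ltn_ord j.
    by rewrite /in_grid /=; lia.
  rewrite !inE /= => gk gk' ne; apply/fdisjointP => c0; rewrite !mem_placed_atom /=.
  move=> /eqP->; apply: contraNneq ne => -[/val_inj ei /val_inj ej].
  move: gk'; rewrite -ei -ej (eqP gk) => /eqP/val_inj->.
  by rewrite eqxx.
- by apply/matrixP => i k; rewrite mxE card_set_sum -rg; apply: eq_bigr => j _; rewrite inE.
- by apply/matrixP => i k; rewrite mxE card_set_sum -cg; apply: eq_bigr => j _; rewrite inE.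
Qed.

(** The weights of the corners are 6 + 8 + 6 for colour 0, 6 + 6 + 4 + 4 for colour 1 and 5 + 5 + 5
    + 5 for the empty cell: 20 each time. *)
Definition block_pattern (k p q : nat) : bool :=
  match k with
  | 0 => (p == 1) && (q \in [:: 0; 2; 4])
  | 1 => (p == 1) && (q \in [:: 0; 4]) || (p \in [:: 0; 2]) && (q == 2)
  | _ => (p \in [:: 0; 2]) && (q \in [:: 1; 3])
  end.

(** The line sums of [n] patterns of which [a] have colour 0, [c] have colour 1 and [b] are empty.
    In the converse direction the zeros are what confines corners to rows 0-2 and columns 0-4. *)
Definition row_entries (n a c : nat) : seq nat :=
  let b := n - (a + c) in
  [:: 2 * b + c; 3 * a + 2 * c; 2 * b + c; 0; 0; 0].

Definition col_entries (n a c : nat) : seq nat :=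
  let b := n - (a + c) in
  [:: a + c; 2 * b; a + 2 * c; 2 * b; a + c; 0].

Definition colour_count (n k : nat) (h : nat -> nat) : nat := \sum_(j < n) (h j == k).

Lemma colour_countS n k h : colour_count n.+1 k h = colour_count n k h + (h n == k).
Proof. exact: big_ord_recr. Qed.

Lemma colour_count0 k h : colour_count 0 k h = 0.
Proof. exact: big_ord0. Qed.

Lemma colour_count_le n h : colour_count n 0 h + colour_count n 1 h <= n.
Proof.
elim: n => [|n IHn]; first by rewrite !colour_count0.
by rewrite !colour_countS; case: (h n) => [|[|k]] /=; lia.
Qed.

Lemma block_pattern_row n (h : nat -> nat) p : p < 6 ->
  \sum_(j < n) \sum_(q < 6) block_pattern (h j) p q =
  nth 0 (row_entries n (colour_count n 0 h) (colour_count n 1 h)) p.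
Proof.
move=> lt_p; elim: n => [|n IHn].
  by rewrite !colour_count0 big_ord0; case: p lt_p => [|[|[|[|[|[|]]]]]].
(* This bound makes the truncated subtraction defining [b] in [row_entries] exact. *)
rewrite big_ord_recr /= IHn !colour_countS; have := colour_count_le n h.
rewrite !big_ord_recr !big_ord0 /=.
by case: (h n) => [|[|k]]; case: p lt_p {IHn} => [|[|[|[|[|[|]]]]]] //= _; lia.
Qed.

Lemma block_pattern_col n (h : nat -> nat) q : q < 6 ->
  \sum_(i < n) \sum_(p < 6) block_pattern (h i) p q =
  nth 0 (col_entries n (colour_count n 0 h) (colour_count n 1 h)) q.
Proof.
move=> lt_q; elim: n => [|n IHn].
  by rewrite !colour_count0 big_ord0; case: q lt_q => [|[|[|[|[|[|]]]]]].
rewrite big_ord_recr /= IHn !colour_countS; have := colour_count_le n h.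
rewrite !big_ord_recr !big_ord0 /=.
by case: (h n) => [|[|k]]; case: q lt_q {IHn} => [|[|[|[|[|[|]]]]]] //= _; lia.
Qed.

Lemma sum_blocks (n : nat) (F : nat -> nat) :
  \sum_(v < n * 6) F v = \sum_(j < n) \sum_(q < 6) F (j * 6 + q).
Proof.
elim: n => [|n IHn]; first by rewrite !big_ord0.
by rewrite mulSnr big_split_ord [RHS]big_ord_recr -IHn.
Qed.

(** * The weight bound for a single block *)

Definition row_weight (p : nat) : nat := nth 0 [:: 0; 4] p.
Definition col_weight (q : nat) : nat := nth 0 [:: 2; 5; 4; 5; 2] q.

Definition line_weight (w : nat) (l : seq bool) : nat :=
  sumn [seq nth false l q * (w + col_weight q) | q <- iota 0 5].

(** Two corners in one line are never adjacent. Generating only such lines leaves 13 of length 5,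
    which keeps the search over three lines small. *)
Fixpoint sparse_lines (m : nat) : seq (seq bool) :=
  match m with
  | 0 => [:: [::]]
  | m'.+1 => [seq false :: l | l <- sparse_lines m'] ++
             [seq true :: l | l <- sparse_lines m' & ~~ head false l]
  end.

Lemma mem_sparse_lines l :
  (forall q, nth false l q -> nth false l q.+1 -> False) ->
  l \in sparse_lines (size l).
Proof.
elim: l => [|b l IHl] //= sep; rewrite mem_cat.
have lS : l \in sparse_lines (size l) by apply: IHl => q; apply: (sep q.+1).
case: b sep => sep; apply/orP; [right|left]; apply: map_f => //.
by rewrite mem_filter lS andbT -nth0; apply/negP => /(sep 0 isT).
Qed.

(** At [q = 0] the test at [q.-1] merely repeats the one at [q], and at [q = 4] the last one reads
    the default value. *)
Definition lines_apart (l l' : seq bool) : bool :=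
  all (fun q => nth false l q ==>
    [&& ~~ nth false l' q.-1, ~~ nth false l' q & ~~ nth false l' q.+1])
    (iota 0 5).

Definition block_line (k p : nat) : seq bool := mkseq (block_pattern k p) 5.

Lemma board_check :
  all (fun l1 => all (fun l0 => lines_apart l0 l1 ==>
    all (fun l2 => lines_apart l2 l1 ==>
      let w := line_weight 0 l0 + line_weight 4 l1 + line_weight 0 l2 in
      (w < 20) || (w == 20) &&
        (let k := if nth false l0 1 then 2 else if nth false l0 2 then 1 else 0 in
         [&& l0 == block_line k 0, l1 == block_line k 1 & l2 == block_line k 2]))
    (sparse_lines 5)) (sparse_lines 5)) (sparse_lines 5).
Proof. by vm_compute. Qed.

Definition apart (u v u' v' : nat) : bool :=
  [|| u.+1 < u', u'.+1 < u, v.+1 < v' | v'.+1 < v].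

Lemma block_pattern_out k p q : (2 < p) || (4 < q) -> block_pattern k p q = false.
Proof. by case: k => [|[|k]] /=; rewrite !inE; lia. Qed.

Definition block_weight (x : nat -> nat -> bool) : nat :=
  \sum_(p < 6) \sum_(q < 6) x p q * (row_weight p + col_weight q).

Definition block_colour (x : nat -> nat -> bool) : nat :=
  if x 0 1 then 2 else if x 0 2 then 1 else 0.

(** The form [?= iff] records the extremal packings, so that [leqif_sum] can carry the equality case
    from the sum over all blocks back to each of them. *)
Lemma block_weight_le (x : nat -> nat -> bool) :
  (forall p q, p < 6 -> q < 6 -> (2 < p) || (4 < q) -> x p q = false) ->
  (forall p q p' q', x p q -> x p' q' -> (p, q) != (p', q') -> apart p q p' q') ->
  block_weight x <= 20 ?= iff
    [forall p : 'I_6, forall q : 'I_6, x p q == block_pattern (block_colour x) p q].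
Proof.
move=> x0 sep; pose l p := mkseq (x p) 5.
have nthl p q : nth false (l p) q = (q < 5) && x p q.
  case: ltnP => lt_q; first by rewrite nth_mkseq.
  by rewrite nth_default ?size_mkseq.
have sp p : l p \in sparse_lines 5.
  have := @mem_sparse_lines (l p); rewrite size_mkseq; apply=> q.
  rewrite !nthl => /andP[_ x1] /andP[_ x2].
  have ne : (p, q) != (p, q.+1) by rewrite xpair_eqE; lia.
  by have := sep _ _ _ _ x1 x2 ne; rewrite /apart; lia.
have la p p' : p != p' -> p <= p'.+1 -> p' <= p.+1 -> lines_apart (l p) (l p').
  move=> ne le1 le2; apply/allP => q _; apply/implyP; rewrite !nthl => /andP[_ x1].
  by apply/and3P; split; apply/negP => /andP[_ x2];
    (have /sep : x p q by []); move=> /(_ _ _ x2); rewrite xpair_eqE /apart; lia.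
have /allP C1 := board_check; have /allP C0 := C1 _ (sp 1).
have /implyP/(_ (la 0 1 isT isT isT))/allP C2 := C0 _ (sp 0).
have {C0 C1 C2} /implyP/(_ (la 2 1 isT isT isT)) := C2 _ (sp 2); cbv zeta.
have -> : line_weight 0 (l 0) + line_weight 4 (l 1) + line_weight 0 (l 2) = block_weight x.
  rewrite /line_weight /block_weight !big_ord_recr !big_ord0 /=.
  rewrite !(x0 3, x0 4, x0 5) ?(x0 0 5, x0 1 5, x0 2 5) //=.
  by rewrite !(mul0n, addn0, add0n, addnA).
rewrite !nthl /= -/(block_colour x) => H; split; first by case/orP: H => [|/andP[/eqP->]] //; lia.
case/orP: H => [lt20|/andP[/eqP w20 /and3P[/eqP e0 /eqP e1 /eqP e2]]].
  (* A block lighter than 20 cannot be a pattern, as all three patterns weigh exactly 20. *)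
  rewrite (ltn_eqF lt20); symmetry; apply/negP => /'forall_'forall_eqP E.
  suff : block_weight x = 20 by lia.
  rewrite /block_weight.
  under eq_bigr do under eq_bigr do rewrite E.
  by rewrite /block_colour; case: ifP => _; [|case: ifP => _]; rewrite !big_ord_recr !big_ord0.
rewrite w20 eqxx; symmetry; apply/'forall_'forall_eqP => p q.
have e p' q' : p' < 3 -> q' < 5 -> x p' q' = block_pattern (block_colour x) p' q'.
  move=> lt_p lt_q; have : nth false (l p') q' = nth false (block_line (block_colour x) p') q'.
    by case: p' lt_p => [|[|[|]]] // _; rewrite (e0, e1, e2).
  by rewrite !nth_mkseq.
case: (boolP ((2 < p) || (4 < q))) => [out|/norP[]]; last first.
  by rewrite -!leqNgt => lt_p lt_q; apply: e; lia.
by rewrite x0 ?ltn_ord // block_pattern_out.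
Qed.

Lemma block_pattern_apart k p q p' q' : p < 6 -> q < 6 -> p' < 6 -> q' < 6 ->
  block_pattern k p q -> block_pattern k p' q' -> (p, q) != (p', q') ->
  apart p q p' q'.
Proof.
have check : all (fun k => all (fun x => all (fun y =>
    [&& block_pattern k x.1 x.2, block_pattern k y.1 y.2 & x != y] ==>
      apart x.1 x.2 y.1 y.2)
    (allpairs pair (iota 0 6) (iota 0 6))) (allpairs pair (iota 0 6) (iota 0 6)))
    (iota 0 3) by vm_compute.
have cell r s : r < 6 -> s < 6 -> (r, s) \in allpairs pair (iota 0 6) (iota 0 6).
  by move=> lt_r lt_s; apply: allpairs_f; rewrite mem_iota.
move=> lp lq lp' lq' x y ne.
(* All values from 2 on share the empty pattern, so the finite check on three values covers every
   [k]. *)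
have [k' lt_k' ek] : exists2 k', k' < 3 & block_pattern k = block_pattern k'.
  by case: k {x y} => [|[|k]]; [exists 0|exists 1|exists 2].
move: x y; rewrite ek => x y.
have k'3 : k' \in iota 0 3 by rewrite mem_iota.
have /allP/(_ _ (cell _ _ lp lq))/allP/(_ _ (cell _ _ lp' lq'))/implyP := allP check _ k'3.
by apply; rewrite x y ne.
Qed.

(** * From a colouring to a packing *)

Definition packing_of_colouring (n : nat) (g : nat -> nat -> nat) (u v : nat) : bool :=
  [&& u < n * 6, v < n * 6 & block_pattern (g (u %/ 6) (v %/ 6)) (u %% 6) (v %% 6)].

Lemma packing_of_colouringE n g i p j q : i < n -> p < 6 -> j < n -> q < 6 ->
  packing_of_colouring n g (i * 6 + p) (j * 6 + q) = block_pattern (g i j) p q.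
Proof.
move=> li lp lj lq; rewrite /packing_of_colouring.
rewrite !divnMDl // !modnMDl !divn_small // !modn_small // !addn0.
by have [-> ->] : i * 6 + p < n * 6 /\ j * 6 + q < n * 6 by lia.
Qed.

Lemma packing_of_colouringP n g : square_packing (n * 6) (packing_of_colouring n g).
Proof.
have bound u v : packing_of_colouring n g u v -> u %% 6 <= 2 /\ v %% 6 <= 4.
  case/and3P=> _ _; case: (boolP ((2 < u %% 6) || (4 < v %% 6))).
    by move/block_pattern_out->.
  by case/norP; lia.
split=> [u v Suv|u v u' v' Suv Suv' ne].
  by have [bu bv] := bound _ _ Suv; case/and3P: Suv; lia.
rewrite -/(apart u v u' v').
have [bu bv] := bound _ _ Suv; have [bu' bv'] := bound _ _ Suv'.
(* Residues are at most 2 and 4, so corners in different blocks are at least two apart in some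
   coordinate; only corners within one block remain. *)
have [eu|nu] := eqVneq (u %/ 6) (u' %/ 6); last by rewrite /apart; lia.
have [ev|nv] := eqVneq (v %/ 6) (v' %/ 6); last by rewrite /apart; lia.
case/and3P: Suv => _ _ P; case/and3P: Suv' => _ _; rewrite -eu -ev => P'.
have {P P'} := block_pattern_apart (ltn_pmod _ _) (ltn_pmod _ _) (ltn_pmod _ _) (ltn_pmod _ _) P P'.
move=> /(_ isT isT isT isT); rewrite xpair_eqE => ap.
have : (u %% 6 == u' %% 6) && (v %% 6 == v' %% 6) = false.
  apply: contraNF ne => /andP[/eqP e1 /eqP e2].
  by rewrite (divn_eq u 6) (divn_eq v 6) eu ev e1 e2 -!divn_eq.
by move=> /negbT /ap; rewrite /apart; lia.
Qed.

Lemma sum_row_blocks n (S : nat -> nat -> bool) (g : nat -> nat -> nat) i p :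
  (forall j q, j < n -> q < 6 -> S (i * 6 + p) (j * 6 + q) = block_pattern (g i j) p q) ->
  p < 6 -> \sum_(v < n * 6) S (i * 6 + p) v =
  nth 0 (row_entries n (colour_count n 0 (g i)) (colour_count n 1 (g i))) p.
Proof.
move=> E lp; rewrite -block_pattern_row // (sum_blocks _ (fun v => S (i * 6 + p) v)).
by apply: eq_bigr => j _; apply: eq_bigr => q _; rewrite E.
Qed.

Lemma sum_col_blocks n (S : nat -> nat -> bool) (g : nat -> nat -> nat) j q :
  (forall i p, i < n -> p < 6 -> S (i * 6 + p) (j * 6 + q) = block_pattern (g i j) p q) ->
  q < 6 -> \sum_(u < n * 6) S u (j * 6 + q) =
  nth 0 (col_entries n (colour_count n 0 (g^~ j)) (colour_count n 1 (g^~ j))) q.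
Proof.
move=> E lq; rewrite -block_pattern_col // (sum_blocks _ (fun u => S u (j * 6 + q))).
by apply: eq_bigr => i _; apply: eq_bigr => p _; rewrite E.
Qed.

Definition colouring_with n (a c a' c' : nat -> nat) (g : nat -> nat -> nat) : Prop :=
  (forall i, i < n -> colour_count n 0 (g i) = a i /\ colour_count n 1 (g i) = c i) /\
  (forall j, j < n ->
     colour_count n 0 (g^~ j) = a' j /\ colour_count n 1 (g^~ j) = c' j).

Definition packing_with n (a c a' c' : nat -> nat) (S : nat -> nat -> bool) : Prop :=
  [/\ square_packing (n * 6) S,
      forall i p, i < n -> p < 6 ->
        \sum_(v < n * 6) S (i * 6 + p) v = nth 0 (row_entries n (a i) (c i)) p
    & forall j q, j < n -> q < 6 ->
        \sum_(u < n * 6) S u (j * 6 + q) = nth 0 (col_entries n (a' j) (c' j)) q].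

Lemma colouring_packing n a c a' c' g : colouring_with n a c a' c' g ->
  packing_with n a c a' c' (packing_of_colouring n g).
Proof.
move=> [rg cg]; split=> [|i p li lp|j q lj lq]; first exact: packing_of_colouringP.
  have [<- <-] := rg _ li; apply: sum_row_blocks => // j q lj lq.
  exact: packing_of_colouringE.
have [<- <-] := cg _ lj; apply: sum_col_blocks => // i p li lp.
exact: packing_of_colouringE.
Qed.

(** * From a packing to a colouring *)

Section PackingToColouring.
Variables (n : nat) (a c a' c' : nat -> nat) (S : nat -> nat -> bool).
Hypotheses (rows_le : forall i, i < n -> a i + c i <= n)
  (cols_le : forall j, j < n -> a' j + c' j <= n)
  (colour1_le : \sum_(j < n) c' j <= \sum_(i < n) c i)
  (packS : packing_with n a c a' c' S).

Let block i j p q := S (i * 6 + p) (j * 6 + q).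

(** The weight is arbitrary because two choices are needed: the constant 1, which counts squares,
    and [row_weight]. *)
Lemma sum_block_rows (w : nat -> nat) :
  \sum_(i < n) \sum_(j < n) \sum_(p < 6) \sum_(q < 6) block i j p q * w p =
  \sum_(i < n) \sum_(p < 6) nth 0 (row_entries n (a i) (c i)) p * w p.
Proof.
case: packS => _ RS _; apply: eq_bigr => i _; rewrite exchange_big /=.
apply: eq_bigr => p _; rewrite -RS ?ltn_ord //.
rewrite (sum_blocks _ (fun v => S (i * 6 + p) v)) big_distrl /=.
by apply: eq_bigr => j _; rewrite big_distrl.
Qed.

Lemma sum_block_cols (w : nat -> nat) :
  \sum_(i < n) \sum_(j < n) \sum_(p < 6) \sum_(q < 6) block i j p q * w q =
  \sum_(j < n) \sum_(q < 6) nth 0 (col_entries n (a' j) (c' j)) q * w q.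
Proof.
case: packS => _ _ CS; rewrite exchange_big; apply: eq_bigr => j _ /=.
under eq_bigr do rewrite exchange_big /=.
rewrite exchange_big; apply: eq_bigr => q _ /=; rewrite -CS ?ltn_ord //.
rewrite (sum_blocks _ (fun u => S u (j * 6 + q))) big_distrl /=.
by apply: eq_bigr => i _; rewrite big_distrl.
Qed.

Lemma sum_nat_scale (k : nat) (F : nat -> nat) : \sum_(i < n) k * F i = k * \sum_(i < n) F i.
Proof. by rewrite big_distrr. Qed.

Lemma block_apart i j p q p' q' : block i j p q -> block i j p' q' ->
  (p, q) != (p', q') -> apart p q p' q'.
Proof.
case: packS => -[_ sepS] _ _ x y ne.
have := sepS _ _ _ _ x y; rewrite xpair_eqE !eqn_add2l -xpair_eqE => /(_ ne).
by rewrite /apart; lia.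
Qed.

Lemma block_zero i j p q : i < n -> j < n -> p < 6 -> q < 6 ->
  (2 < p) || (4 < q) -> block i j p q = false.
Proof.
case: packS => _ RS CS li lj lp lq out; apply/negP => x.
have [lu lv] : i * 6 + p < n * 6 /\ j * 6 + q < n * 6 by lia.
case/orP: out => out.
  have : \sum_(v < n * 6) S (i * 6 + p) v = 0.
    by rewrite RS //; case: p out lp {x lu} => [|[|[|[|[|[|]]]]]].
  by move/eqP; rewrite sum_nat_eq0 => /forallP/(_ (Ordinal lv)) /=; move: x; rewrite /block => ->.
have : \sum_(u < n * 6) S u (j * 6 + q) = 0.
  by rewrite CS //; case: q out lq {x lv} => [|[|[|[|[|[|]]]]]].
by move/eqP; rewrite sum_nat_eq0 => /forallP/(_ (Ordinal lu)) /=; move: x; rewrite /block => ->.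
Qed.

Lemma block_weight_total :
  20 * (n * n) <= \sum_(i < n) \sum_(j < n) block_weight (block i j).
Proof.
pose A := \sum_(i < n) a i; pose C := \sum_(i < n) c i.
pose A' := \sum_(j < n) a' j; pose C' := \sum_(j < n) c' j.
have sumK k : \sum_(i < n) k = k * n by rewrite sum_nat_const card_ord mulnC.
(* Counting all squares by rows and by columns: a line of blocks with [a] cells of colour 0 has
   [4 * n - a] squares in either direction. *)
have AA' : A = A'.
  have := sum_block_rows (fun=> 1); rewrite (sum_block_cols (fun=> 1)) => E.
  have rE : \sum_(i < n) \sum_(p < 6) nth 0 (row_entries n (a i) (c i)) p * 1 + A = 4 * n * n.
    rewrite -sumK -big_split; apply: eq_bigr => i _ /=.
    by have := rows_le (ltn_ord i); rewrite !big_ord_recr big_ord0 /=; lia.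
  have cE : \sum_(j < n) \sum_(q < 6) nth 0 (col_entries n (a' j) (c' j)) q * 1 + A' = 4 * n * n.
    rewrite -sumK -big_split; apply: eq_bigr => j _ /=.
    by have := cols_le (ltn_ord j); rewrite !big_ord_recr big_ord0 /=; lia.
  by lia.
have -> : \sum_(i < n) \sum_(j < n) block_weight (block i j) =
    \sum_(i < n) \sum_(p < 6) nth 0 (row_entries n (a i) (c i)) p * row_weight p +
    \sum_(j < n) \sum_(q < 6) nth 0 (col_entries n (a' j) (c' j)) q * col_weight q.
  rewrite -sum_block_rows -sum_block_cols -big_split; apply: eq_bigr => i _ /=.
  rewrite -big_split; apply: eq_bigr => j _ /=; rewrite -big_split.
  apply: eq_bigr => p _ /=; rewrite -big_split; apply: eq_bigr => q _ /=.
  by rewrite mulnDr.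
have -> : \sum_(i < n) \sum_(p < 6) nth 0 (row_entries n (a i) (c i)) p * row_weight p =
    12 * A + 8 * C.
  rewrite -!sum_nat_scale -big_split; apply: eq_bigr => i _ /=.
  by rewrite !big_ord_recr big_ord0 /= /row_weight /=; lia.
(* The columns contribute [20 * n * n - (12 * A' + 8 * C')], written additively to avoid truncation.
   With [A = A'] the total is at least [20 * n * n] as soon as [C' <= C]. *)
have cE : \sum_(j < n) \sum_(q < 6) nth 0 (col_entries n (a' j) (c' j)) q * col_weight q +
    (12 * A' + 8 * C') = 20 * n * n.
  rewrite -sumK -!sum_nat_scale -big_split -big_split; apply: eq_bigr => j _ /=.
  have := cols_le (ltn_ord j).
  by rewrite !big_ord_recr big_ord0 /= /col_weight /=; lia.
have : C' <= C by [].
by lia.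
Qed.

Lemma block_is_pattern i j p q : i < n -> j < n -> p < 6 -> q < 6 ->
  block i j p q = block_pattern (block_colour (block i j)) p q.
Proof.
move=> li lj lp lq.
have le20 : \sum_(x : 'I_n * 'I_n) block_weight (block x.1 x.2) <=
    \sum_(x : 'I_n * 'I_n) 20 ?= iff [forall x : 'I_n * 'I_n, [forall p : 'I_6,
      forall q : 'I_6, block x.1 x.2 p q ==
                       block_pattern (block_colour (block x.1 x.2)) p q]].
  apply: leqif_sum => x _; apply: block_weight_le => [r s lr ls out|r s r' s' b b' ne].
    exact: block_zero.
  exact: block_apart b b' ne.
have [le E] := le20; move: le E.
rewrite sum_nat_const card_prod card_ord [_ * 20]mulnC => le.
have := block_weight_total; rewrite pair_bigA /= => ge; rewrite eqn_leq le ge => /esym/forallP.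
by move=> /(_ (Ordinal li, Ordinal lj))/forallP/(_ (Ordinal lp))/forallP/(_ (Ordinal lq))/eqP.
Qed.

Lemma packing_colouring :
  colouring_with n a c a' c' (fun i j => block_colour (block i j)).
Proof.
case: packS => _ RS CS; set g := fun i j => _; split=> [i li|j lj].
- have R' p (lp : p < 6) := @sum_row_blocks n S g i p
    (fun j q lj lq => block_is_pattern li lj lp lq) lp.
  have := colour_count_le n (g i); have := rows_le li.
  (* Row entries 0 and 1 are [2 * n - 2 * a - c] and [3 * a + 2 * c], a system of determinant -1.
     For columns, entries 0 and 2 are [a + c] and [a + 2 * c]. *)
  have := R' 0 isT; have := R' 1 isT; rewrite !RS //=; lia.
- have C' q (lq : q < 6) := @sum_col_blocks n S g j q
    (fun i p li lp => block_is_pattern li lj lp lq) lq.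
  have := colour_count_le n (g^~ j); have := cols_le lj.
  have := C' 0 isT; have := C' 2 isT; rewrite !CS //=; lia.
Qed.

End PackingToColouring.

(** * The reduction as a stack program *)

Section TimedRuns.
Variable A : Type.
Implicit Types (p q : prog A) (s : seq (seq A)) (f : option A -> bool).

Definition runs p (b : nat) s s' : Prop := exists2 t, t <= b & exec p t s s'.

Lemma runs_leq p b b' s s' : b <= b' -> runs p b s s' -> runs p b' s s'.
Proof. by move=> le_b [t le_t E]; exists t => //; apply: leq_trans le_b. Qed.

Lemma runs_push i a s : runs (Push i a) 2 s (set_stack s i (a :: stack s i)).
Proof. by exists 2 => //; constructor. Qed.

Lemma runs_pop i s : runs (Pop i) 1 s (set_stack s i (behead (stack s i))).
Proof. by exists 1 => //; constructor. Qed.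

Lemma runs_seq p q b1 b2 s1 s2 s3 :
  runs p b1 s1 s2 -> runs q b2 s2 s3 -> runs (Seq p q) (b1 + b2) s1 s3.
Proof.
by move=> [t1 l1 E1] [t2 l2 E2]; exists (t1 + t2); [apply: leq_add|apply: ExecSeq E1 E2].
Qed.

Lemma runs_if_true i f p q b s s' : f (ohead (stack s i)) ->
  runs p b s s' -> runs (If i f p q) b.+1 s s'.
Proof. by move=> fi [t l E]; exists t.+1 => //; apply: ExecIfTrue. Qed.

Lemma runs_if_false i f p q b s s' : ~~ f (ohead (stack s i)) ->
  runs q b s s' -> runs (If i f p q) b.+1 s s'.
Proof. by move=> fi [t l E]; exists t.+1 => //; apply: ExecIfFalse. Qed.

Lemma runs_while_true i f p b1 b2 s1 s2 s3 : f (ohead (stack s1 i)) ->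
  runs p b1 s1 s2 -> runs (While i f p) b2 s2 s3 ->
  runs (While i f p) (b1 + b2).+1 s1 s3.
Proof.
move=> fi [t1 l1 E1] [t2 l2 E2]; exists (t1 + t2).+1; last exact: ExecWhileTrue E1 E2.
by rewrite ltnS leq_add.
Qed.

Lemma runs_while_false i f p s : ~~ f (ohead (stack s i)) -> runs (While i f p) 1 s s.
Proof. by exists 1 => //; constructor. Qed.

End TimedRuns.

(** * Binary increment and addition of multiples *)

Fixpoint incr_bits (l : seq bool) : seq bool :=
  match l with
  | [::] => [:: true]
  | false :: l' => true :: l'
  | true :: l' => false :: incr_bits l'
  end.

Lemma bits_of_natS m : bits_of_nat m.+1 = incr_bits (bits_of_nat m).
Proof.
have bits_pos p : bits_of_nat (nat_of_pos p) = bits_of_pos p.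
  by rewrite /bits_of_nat (nat_of_binK (Npos p)).
rewrite -[in RHS](bin_of_natK m) -[in LHS](bin_of_natK m).
case: (bin_of_nat m) => [|p] //=; rewrite bits_pos.
have [p' [<- ->]] : exists p', nat_of_pos p' = (nat_of_pos p).+1 /\
    incr_bits (bits_of_pos p) = bits_of_pos p'; last exact: bits_pos.
elim: p => [p [p' [IH1 IH2]]|p _|] /=.
- by exists (xO p'); rewrite /= !natTrecE IH1 IH2 doubleS.
- by exists (xI p).
- by exists (xO xH).
Qed.

Definition nat_of_bits (l : seq bool) : nat := foldr (fun (b : bool) v => 2 * v + b) 0 l.

Lemma bits_of_natK m : nat_of_bits (bits_of_nat m) = m.
Proof.
elim: m => // m IHm; rewrite bits_of_natS -{2}IHm.
by elim: (bits_of_nat m) => [|[] l IHl] //=; rewrite ?IHl; lia.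
Qed.

(** This crude bound suffices: the numbers being incremented are at most six times a counter, and
    counters are bounded by the input length. *)
Lemma size_bits_of_nat m : size (bits_of_nat m) <= m.
Proof.
elim: m => // m IHm; rewrite bits_of_natS.
suff : size (incr_bits (bits_of_nat m)) <= (size (bits_of_nat m)).+1 by lia.
by elim: (bits_of_nat m) => [|[] l] /=; lia.
Qed.

Notation letter := (option bool).
Definition tick : letter := None.
Definition unary (m : nat) : seq letter := nseq m tick.

Lemma behead_unary m : behead (unary m.+1) = unary m. Proof. by []. Qed.

Lemma cons_unary m : tick :: unary m = unary m.+1. Proof. by []. Qed.

Definition is_digit (x : option letter) : bool := if x is Some (Some _) then true else false.
Definition is_bit (b : bool) (x : option letter) : bool := x == Some (Some b).

(** A loop whose test always fails serves as the empty program. *)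
Definition skip : prog letter := While 0 (fun=> false) (Pop 0).

Lemma runs_skip s : runs skip 1 s s.
Proof. exact: runs_while_false. Qed.

Definition bits_word (m : nat) : seq letter := map Some (bits_of_nat m).

(** The number lies on top of the output, least significant digit first. Its leading ones are moved
    to stack 10, a following zero (but not the end marker) is dropped, a one is pushed, and the
    carried ones come back as zeros. *)
Definition increment : prog letter :=
  Seq (While 11 (is_bit true) (Seq (Pop 11) (Push 10 tick)))
 (Seq (If 11 (is_bit false) (Pop 11) skip)
 (Seq (Push 11 (Some true))
      (While 10 isSome (Seq (Pop 10) (Push 11 (Some false)))))).

Section Increment.
(** [F] gives all the stacks as a function of those the program touches. For [state] the hypotheses
    hold by computation, so one proof serves for every choice of stacks; the later sections use the
    same device. *)
Variable F : nat -> seq letter -> seq (seq letter).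
Hypotheses (F10 : forall w o, stack (F w o) 10 = unary w)
  (F11 : forall w o, stack (F w o) 11 = o)
  (F10s : forall w w' o, set_stack (F w o) 10 (unary w') = F w' o)
  (F11s : forall w o o', set_stack (F w o) 11 o' = F w o').

Lemma runs_restore_zeros w o :
  runs (While 10 isSome (Seq (Pop 10) (Push 11 (Some false)))) (4 * w).+1
       (F w o) (F 0 (nseq w (Some false) ++ o)).
Proof.
elim: w o => [|w IHw] o; first by apply: runs_while_false; rewrite F10.
have -> : 4 * w.+1 = (1 + 2) + (4 * w).+1 by lia.
apply: runs_while_true; first by rewrite F10.
  apply: runs_seq (runs_pop _ _) (runs_push _ _ _).
rewrite F10 behead_unary F10s F11 F11s.
by have := IHw (Some false :: o); rewrite -cat_rcons -cats1 -(nseqD w 1) addn1.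
Qed.

Lemma runs_increment_bits l o :
  runs increment (8 * size l + 8)
    (F 0 (map Some l ++ None :: o)) (F 0 (map Some (incr_bits l) ++ None :: o)).
Proof.
rewrite /increment.
(* Generalised to [w] ones already carried; the result is only required to be right once the [w']
   zeros have been put back, which makes the induction on [l] go through. *)
suff H w : exists2 w', w' <= w + size l & exists r,
    runs (While 11 (is_bit true) (Seq (Pop 11) (Push 10 tick))) (4 * size l).+1
      (F w (map Some l ++ None :: o)) (F w' r) /\
    exists2 r', runs (If 11 (is_bit false) (Pop 11) skip) 2 (F w' r) (F w' r') &
      nseq w' (Some false) ++ Some true :: r' =
      nseq w (Some false) ++ map Some (incr_bits l) ++ None :: o.
  have [w' le_w' [r [R1 [r' R2 /= <-]]]] := H 0.
  have R3 := runs_push 11 (Some true) (F w' r'); rewrite F11 F11s in R3.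
  have R4 := runs_restore_zeros w' (Some true :: r').
  by apply: runs_leq (runs_seq R1 (runs_seq R2 (runs_seq R3 R4))); lia.
elim: l w => [|[] l IHl] w.
- exists w; first by lia.
  exists (None :: o); split; first by apply: runs_while_false; rewrite F11.
  exists (None :: o) => //; apply: runs_if_false; rewrite ?F11 //; exact: runs_skip.
- have [w' le_w' [r [R1 [r' R2 e]]]] := IHl w.+1.
  exists w'; first by rewrite /=; lia.
  exists r; split; last first.
    by exists r' => //; rewrite e -addn1 nseqD -catA.
  apply: (@runs_leq _ _ ((1 + 2) + (4 * size l).+1).+1); first by rewrite /=; lia.
  apply: runs_while_true R1; first by rewrite F11.
  have := runs_seq (runs_pop 11 (F w (map Some (true :: l) ++ None :: o))) (runs_push 10 tick _).
  by rewrite F11 F11s F10 cons_unary F10s.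
- exists w; first by lia.
  exists (map Some (false :: l) ++ None :: o); split.
    by apply: (@runs_leq _ _ 1) => //; apply: runs_while_false; rewrite F11.
  exists (map Some l ++ None :: o) => //; apply: runs_if_true; first by rewrite F11.
  by have := runs_pop 11 (F w (map Some (false :: l) ++ None :: o)); rewrite F11 F11s.
Qed.

Lemma runs_increment m o :
  runs increment (8 * m + 8)
    (F 0 (bits_word m ++ None :: o)) (F 0 (bits_word m.+1 ++ None :: o)).
Proof.
rewrite /bits_word bits_of_natS; apply: runs_leq (runs_increment_bits _ _).
by have := size_bits_of_nat m; lia.
Qed.

End Increment.

(** The factor is a constant of the program and is unrolled into increments. The counter passes
    through stack 6 and is restored, as it is needed for the next entries. *)
Definition add_multiple (U k : nat) : prog letter :=
  Seq (While U isSome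
        (Seq (Pop U) (Seq (Push 6 tick) (iter k (Seq increment) skip))))
      (While 6 isSome (Seq (Pop 6) (Push U tick))).

Section AddMultiple.
Variables (U : nat) (F : nat -> nat -> nat -> seq letter -> seq (seq letter)).
Hypotheses (FU : forall u t w o, stack (F u t w o) U = unary u)
  (F6 : forall u t w o, stack (F u t w o) 6 = unary t)
  (F10 : forall u t w o, stack (F u t w o) 10 = unary w)
  (F11 : forall u t w o, stack (F u t w o) 11 = o)
  (FUs : forall u t w o u', set_stack (F u t w o) U (unary u') = F u' t w o)
  (F6s : forall u t w o t', set_stack (F u t w o) 6 (unary t') = F u t' w o)
  (F10s : forall u t w o w', set_stack (F u t w o) 10 (unary w') = F u t w' o)
  (F11s : forall u t w o o', set_stack (F u t w o) 11 o' = F u t w o').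

Lemma runs_increments k u t m o M : m + k <= M ->
  runs (iter k (Seq increment) skip) (k * (8 * M + 8) + 1)
    (F u t 0 (bits_word m ++ None :: o)) (F u t 0 (bits_word (m + k) ++ None :: o)).
Proof.
elim: k m => [|k IHk] m le_M; first by rewrite addn0; apply: runs_skip.
have R1 := runs_increment (F10 u t) (F11 u t)
  (fun w w' o => F10s u t w o w') (F11s u t) m o.
have le_M' : m.+1 + k <= M by lia.
have R2 := IHk _ le_M'; rewrite addSnnS in R2.
by apply: runs_leq (runs_seq R1 R2); lia.
Qed.

Lemma runs_add_multiple k u m o M : m + k * u <= M ->
  runs (add_multiple U k) (u * (k * (8 * M + 8) + 9) + 2)
    (F u 0 0 (bits_word m ++ None :: o))
    (F u 0 0 (bits_word (m + k * u) ++ None :: o)).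
Proof.
move=> le_M; set o1 := bits_word (m + k * u) ++ None :: o.
have R2 v t : runs (While 6 isSome (Seq (Pop 6) (Push U tick))) (4 * t).+1
    (F v t 0 o1) (F (v + t) 0 0 o1).
  elim: t v => [|t IHt] v; first by rewrite addn0; apply: runs_while_false; rewrite F6.
  have := runs_seq (runs_pop 6 (F v t.+1 0 o1)) (runs_push U tick _).
  rewrite F6 behead_unary F6s FU cons_unary FUs => B.
  rewrite addnS -addSn; apply: runs_leq (runs_while_true _ B (IHt _)); first by lia.
  by rewrite F6.
suff R1 t m' : m' + k * u <= M ->
    runs (While U isSome (Seq (Pop U) (Seq (Push 6 tick) (iter k (Seq increment) skip))))
      (u * (k * (8 * M + 8) + 5) + 1)
      (F u t 0 (bits_word m' ++ None :: o))
      (F 0 (t + u) 0 (bits_word (m' + k * u) ++ None :: o)).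
  have := runs_seq (R1 0 m le_M) (R2 0 u); apply: runs_leq.
  by rewrite [u * (_ + 9)]mulnDr [u * (_ + 5)]mulnDr; lia.
elim: u {le_M o1 R2} t m' => [|u IHu] t m' le_M.
  by rewrite muln0 !addn0; apply: runs_while_false; rewrite FU.
have le1 : m' + k <= M by lia.
have le2 : m' + k + k * u <= M by lia.
have B1 := runs_pop U (F u.+1 t 0 (bits_word m' ++ None :: o)).
have B2 := runs_push 6 tick (F u t 0 (bits_word m' ++ None :: o)).
rewrite FU behead_unary FUs in B1; rewrite F6 cons_unary F6s in B2.
have B := runs_seq B1 (runs_seq B2 (runs_increments u t.+1 o le1)).
have H := runs_while_true _ B (IHu t.+1 (m' + k) le2).
rewrite -(addSnnS t u) [k * u.+1]mulnS addnA.
by apply: runs_leq (H _); rewrite ?FU //; lia.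
Qed.

End AddMultiple.

(* The stacks of the reduction, numbered from 0: input [i]; reversed input [v];
   grid size [n]; colour 0, colour 1 and empty cells [x], [y], [z] of the current
   row or column; scratch [t]; excess [b] of colour 1 in the columns over the
   rows; overflow flag [e]; loop counter [l]; scratch [w] of [increment];
   output [o]. *)
Definition state (i v : seq letter) (n x y z t b e l w : nat) (o : seq letter) :
    seq (seq letter) :=
  [:: i; v; unary n; unary x; unary y; unary z; unary t; unary b; unary e;
      unary l; unary w; o].

(** The coefficients belong to colour 0, the empty cells and colour 1, in this order. The end marker
    goes first because it lies below the digits; on top of it zero is the empty word, ready to be
    increased. *)
Definition emit (c : nat * nat * nat) : prog letter :=
  Seq (Push 11 None)
 (Seq (add_multiple 3 c.1.1) (Seq (add_multiple 5 c.1.2) (add_multiple 4 c.2))).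

Definition combination (x z y : nat) (c : nat * nat * nat) : nat :=
  c.1.1 * x + c.1.2 * z + c.2 * y.

Lemma encode_nats_cons m s o :
  encode_nats (m :: s) ++ o = bits_word m ++ None :: encode_nats s ++ o.
Proof. by rewrite /encode_nats /= -catA cat_rcons. Qed.

Lemma runs_emit c v n x y z b e l o d : 
  x + y + z < d -> c.1.1 <= 6 -> c.1.2 <= 6 -> c.2 <= 6 ->
  runs (emit c) (3000 * (d * d)) (state [::] v n x y z 0 b e l 0 o)
    (state [::] v n x y z 0 b e l 0 (encode_nats [:: combination x z y c] ++ o)).
Proof.
case: c => [[ca cb] cc] lt_d /= la lb lc; rewrite /combination /=.
pose M := 6 * d.
have la' : 0 + ca * x <= M by rewrite /M; nia.
have lb' : ca * x + cb * z <= M by rewrite /M; nia.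
have lc' : ca * x + cb * z + cc * y <= M by rewrite /M; nia.
have R0 := runs_push 11 None (state [::] v n x y z 0 b e l 0 o).
have R1 := @runs_add_multiple 3 (fun u t w o => state [::] v n u y z t b e l w o)
  (fun _ _ _ _ => erefl) (fun _ _ _ _ => erefl) (fun _ _ _ _ => erefl) (fun _ _ _ _ => erefl)
  (fun _ _ _ _ _ => erefl) (fun _ _ _ _ _ => erefl) (fun _ _ _ _ _ => erefl)
  (fun _ _ _ _ _ => erefl) ca x 0 o M la'.
have R2 := @runs_add_multiple 5 (fun u t w o => state [::] v n x y u t b e l w o)
  (fun _ _ _ _ => erefl) (fun _ _ _ _ => erefl) (fun _ _ _ _ => erefl) (fun _ _ _ _ => erefl)
  (fun _ _ _ _ _ => erefl) (fun _ _ _ _ _ => erefl) (fun _ _ _ _ _ => erefl)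
  (fun _ _ _ _ _ => erefl) cb z (ca * x) o M lb'.
have R3 := @runs_add_multiple 4 (fun u t w o => state [::] v n x u z t b e l w o)
  (fun _ _ _ _ => erefl) (fun _ _ _ _ => erefl) (fun _ _ _ _ => erefl) (fun _ _ _ _ => erefl)
  (fun _ _ _ _ _ => erefl) (fun _ _ _ _ _ => erefl) (fun _ _ _ _ _ => erefl)
  (fun _ _ _ _ _ => erefl) cc y (ca * x + cb * z) o M lc'.
rewrite encode_nats_cons; apply: runs_leq (runs_seq R0 (runs_seq R1 (runs_seq R2 R3))).
(* For [c <= 6] and [M = 6 * d] the factor is at most [288 * d + 57], and [0 < d]. *)
have bnd c u : c <= 6 -> u <= d -> u * (c * (8 * M + 8) + 9) <= d * (d * 345).
  by move=> lec leu; apply: leq_mul => //; rewrite /M; nia.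
have := bnd _ x la; have := bnd _ z lb; have := bnd _ y lc.
nia.
Qed.

Fixpoint emit_all (cs : seq (nat * nat * nat)) : prog letter :=
  if cs is c :: cs' then Seq (emit_all cs') (emit c) else skip.

Definition small_coefs (c : nat * nat * nat) : bool :=
  [&& c.1.1 <= 6, c.1.2 <= 6 & c.2 <= 6].

Lemma runs_emit_all cs v n x y z b e l o d :
  x + y + z < d -> all small_coefs cs ->
  runs (emit_all cs) (size cs * (3000 * (d * d)) + 1) (state [::] v n x y z 0 b e l 0 o)
    (state [::] v n x y z 0 b e l 0 (encode_nats (map (combination x z y) cs) ++ o)).
Proof.
move=> lt_d; elim: cs => [|c cs IHcs] /=; first by move=> _; apply: runs_skip.
case/andP=> /and3P[la lb lc] /IHcs R.
have {R} := runs_seq R (runs_emit _ _ _ _ _ _ lt_d la lb lc).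
by rewrite !encode_nats_cons; apply: runs_leq; lia.
Qed.

(** Stack 5 is the supply of cells not yet assigned; when it is empty, stack 8 records an overflow
    instead. *)
Definition take_unit (U : nat) : prog letter :=
  If 5 isSome (Seq (Pop 5) (Push U tick)) (Push 8 tick).

(* Invariant: stacks [U] and 5 together keep their number of ticks, so that a
   number exceeding the ticks available is detected, and reported on stack 8,
   before [U] gets large. *)
Definition read_number (U : nat) : prog letter :=
  Seq (Pop 1)
 (While 1 is_digit
   (Seq (While U isSome (Seq (Pop U) (Seq (Push 6 tick) (take_unit 6))))
   (Seq (While 6 isSome (Seq (Pop 6) (Push U tick)))
   (Seq (If 1 (is_bit true) (take_unit U) skip)
        (Pop 1))))).

(** On the reversed input the most significant digit comes first. *)
Definition horner_bits (u : nat) (l : seq bool) : nat :=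
  foldl (fun v (b : bool) => 2 * v + b) u l.

Lemma horner_bits_ge u l : u <= horner_bits u l.
Proof. by elim: l u => //= b l IHl u; apply: leq_trans (IHl _); lia. Qed.

Lemma horner_bits_rev m : horner_bits 0 (rev (bits_of_nat m)) = m.
Proof. by rewrite /horner_bits foldl_rev; exact: bits_of_natK. Qed.

Section ReadNumber.
Variables (U : nat) (F : seq letter -> nat -> nat -> nat -> nat -> seq (seq letter)).
Hypotheses (F1 : forall v u z t e, stack (F v u z t e) 1 = v)
  (FU : forall v u z t e, stack (F v u z t e) U = unary u)
  (F5 : forall v u z t e, stack (F v u z t e) 5 = unary z)
  (F6 : forall v u z t e, stack (F v u z t e) 6 = unary t)
  (F8 : forall v u z t e, stack (F v u z t e) 8 = unary e)
  (F1s : forall v u z t e v', set_stack (F v u z t e) 1 v' = F v' u z t e)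
  (FUs : forall v u z t e u', set_stack (F v u z t e) U (unary u') = F v u' z t e)
  (F5s : forall v u z t e z', set_stack (F v u z t e) 5 (unary z') = F v u z' t e)
  (F6s : forall v u z t e t', set_stack (F v u z t e) 6 (unary t') = F v u z t' e)
  (F8s : forall v u z t e e', set_stack (F v u z t e) 8 (unary e') = F v u z t e').

Lemma runs_take_unit_6 v u z t e :
  runs (take_unit 6) 4 (F v u z t e) (F v u (z - 1) (t + (0 < z)) (e + (z == 0))).
Proof.
case: z => [|z].
  have := runs_push 8 tick (F v u 0 t e); rewrite F8 cons_unary F8s => R.
  rewrite addn0 addn1; apply: (@runs_leq _ _ 3) => //.
  by apply: runs_if_false R; rewrite F5.
have R1 := runs_pop 5 (F v u z.+1 t e); rewrite F5 behead_unary F5s in R1.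
have R2 := runs_push 6 tick (F v u z t e); rewrite F6 cons_unary F6s in R2.
rewrite subn1 addn0 addn1; apply: runs_if_true (runs_seq R1 R2).
by rewrite F5.
Qed.

Lemma runs_take_unit_U v u z t e :
  runs (take_unit U) 4 (F v u z t e) (F v (u + (0 < z)) (z - 1) t (e + (z == 0))).
Proof.
case: z => [|z].
  have := runs_push 8 tick (F v u 0 t e); rewrite F8 cons_unary F8s => R.
  rewrite addn0 addn1; apply: (@runs_leq _ _ 3) => //.
  by apply: runs_if_false R; rewrite F5.
have R1 := runs_pop 5 (F v u z.+1 t e); rewrite F5 behead_unary F5s in R1.
have R2 := runs_push U tick (F v u z t e); rewrite FU cons_unary FUs in R2.
rewrite subn1 addn0 addn1; apply: runs_if_true (runs_seq R1 R2).
by rewrite F5.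
Qed.

Lemma runs_double v u z t e :
  runs (While U isSome (Seq (Pop U) (Seq (Push 6 tick) (take_unit 6)))) (8 * u).+1
    (F v u z t e) (F v 0 (z - u) (t + u + minn u z) (e + (u - z))).
Proof.
elim: u z t e => [|u IHu] z t e.
  rewrite subn0 !addn0 min0n addn0; apply: runs_while_false; first by rewrite FU.
have R1 := runs_pop U (F v u.+1 z t e); rewrite FU behead_unary FUs in R1.
have R2 := runs_push 6 tick (F v u z t e); rewrite F6 cons_unary F6s in R2.
have R := runs_seq R1 (runs_seq R2 (runs_take_unit_6 v u z t.+1 e)).
have := IHu (z - 1) (t.+1 + (0 < z)) (e + (z == 0)).
have -> : z - 1 - u = z - u.+1 by lia.
have -> : t.+1 + (0 < z) + u + minn u (z - 1) = t + u.+1 + minn u.+1 z by case: (z) => /=; lia.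
have -> : e + (z == 0) + (u - (z - 1)) = e + (u.+1 - z) by case: (z) => /=; lia.
move=> /(runs_while_true _ R) H; apply: runs_leq (H _); last by rewrite FU.
by lia.
Qed.

Lemma runs_move_back v u z t e :
  runs (While 6 isSome (Seq (Pop 6) (Push U tick))) (4 * t).+1
    (F v u z t e) (F v (u + t) z 0 e).
Proof.
elim: t u => [|t IHt] u; first by rewrite addn0; apply: runs_while_false; rewrite F6.
have R1 := runs_pop 6 (F v u z t.+1 e); rewrite F6 behead_unary F6s in R1.
have R2 := runs_push U tick (F v u z t e); rewrite FU cons_unary FUs in R2.
rewrite -addSnnS; have H := runs_while_true _ (runs_seq R1 R2) (IHt _).
by apply: runs_leq (H _); [lia|rewrite F6].
Qed.

(** An entry can be exponential in its length; the fixed supply [u + z] keeps the time polynomial.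
    After an overflow the value read is irrelevant, so only the growth of [e] is recorded. *)
Lemma runs_read_digits bs rest u z e d :
  ~~ is_digit (ohead rest) -> u + z < d ->
  exists u' z' e',
    [/\ runs (While 1 is_digit
             (Seq (While U isSome (Seq (Pop U) (Seq (Push 6 tick) (take_unit 6))))
             (Seq (While 6 isSome (Seq (Pop 6) (Push U tick)))
             (Seq (If 1 (is_bit true) (take_unit U) skip)
                  (Pop 1)))))
          (size bs * (20 * d) + 1)
          (F (map Some bs ++ rest) u z 0 e) (F rest u' z' 0 e'),
        u' + z' = u + z,
        e <= e'
      & if horner_bits u bs <= u + z then u' = horner_bits u bs /\ e' = e else e < e'].
Proof.
move=> nd lt_d; elim: bs u z e lt_d => [|b bs IHbs] u z e lt_d /=.
  exists u, z, e; rewrite leq_addr; split=> //.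
  by apply: runs_while_false; rewrite F1.
set v := _ :: _.
have R1 := runs_double v u z 0 e.
have R2 := runs_move_back v 0 (z - u) (0 + u + minn u z) (e + (u - z)).
pose u1 := u + minn u z; rewrite !add0n -/u1 in R1 R2.
have R3 : runs (If 1 (is_bit true) (take_unit U) skip) 5
    (F v u1 (z - u) 0 (e + (u - z)))
    (F v (u1 + minn b (z - u)) (z - u - b) 0 (e + (u - z) + (b - (z - u)))).
  rewrite /v; case: b @v R1 R2 => v R1 R2.
    have := runs_take_unit_U v u1 (z - u) 0 (e + (u - z)) => R.
    have -> : minn true (z - u) = (0 < z - u) by lia.
    have -> : true - (z - u) = (z - u == 0) by lia.
    by apply: runs_if_true R; rewrite F1.
  rewrite min0n sub0n subn0 !addn0; apply: (@runs_leq _ _ 2) => //.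
  by apply: runs_if_false (runs_skip _); rewrite F1.
set u2 := u1 + _ in R3; set z2 := z - u - b in R3; set e2 := _ + (b - _) in R3.
have R4 := runs_pop 1 (F v u2 z2 0 e2); rewrite F1 F1s /= in R4.
have R := runs_seq R1 (runs_seq R2 (runs_seq R3 R4)).
have uz2 : u2 + z2 = u + z by rewrite /u2 /u1 /z2; lia.
have lt2 : u2 + z2 < d by rewrite uz2.
have [u' [z' [e' [R' uz' le_e val]]]] := IHbs u2 z2 e2 lt2.
exists u', z', e'; split.
- have H := runs_while_true _ R R'.
  apply: runs_leq (H _); last by rewrite F1.
  by rewrite /u1; lia.
- by rewrite uz' uz2.
- by rewrite (leq_trans _ le_e) // /e2 -addnA leq_addr.
- case: (leqP (2 * u + b) (u + z)) => [le_b|gt_b].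
    have [eu ee] : u2 = 2 * u + b /\ e2 = e by rewrite /u2 /u1 /e2; lia.
    by rewrite uz2 eu ee in val.
  (* A prefix never exceeds the whole number, so an overflow at this digit means that the number
     itself is too large. *)
  have lt_e : e < e2 by rewrite /e2; lia.
  move: (leq_trans lt_e le_e) => {}lt_e.
  rewrite ifN // -ltnNge; apply: leq_trans gt_b _; exact: horner_bits_ge.
Qed.

Definition number_word (m : nat) : seq letter := None :: map Some (rev (bits_of_nat m)).

Lemma runs_read_number m rest z e d :
  ~~ is_digit (ohead rest) -> z < d -> size (bits_of_nat m) <= d ->
  exists u z' e',
    [/\ runs (read_number U) (22 * (d * d)) (F (number_word m ++ rest) 0 z 0 e) (F rest u z' 0 e'),
        u + z' = z,
        e <= e'
      & if m <= z then u = m /\ e' = e else e < e'].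
Proof.
move=> nd lt_d sz.
have [u [z' [e' [R uz le_e val]]]] := @runs_read_digits (rev (bits_of_nat m)) rest 0 z e d nd lt_d.
rewrite horner_bits_rev add0n in uz val; exists u, z', e'; split=> //.
have := runs_pop 1 (F (number_word m ++ rest) 0 z 0 e); rewrite F1 F1s => R0.
apply: runs_leq (runs_seq R0 R); rewrite size_rev.
have : size (bits_of_nat m) * (20 * d) <= d * (20 * d) by rewrite leq_mul2r sz orbT.
by nia.
Qed.

End ReadNumber.

(** * Processing the rows and the columns *)

Definition copy_counter (U : nat) : prog letter :=
  Seq (While 2 isSome (Seq (Pop 2) (Push 6 tick)))
      (While 6 isSome (Seq (Pop 6) (Seq (Push 2 tick) (Push U tick)))).

Section CopyCounter.
Variables (U : nat) (F : nat -> nat -> nat -> seq (seq letter)).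
Hypotheses (F2 : forall n u t, stack (F n u t) 2 = unary n)
  (FU : forall n u t, stack (F n u t) U = unary u)
  (F6 : forall n u t, stack (F n u t) 6 = unary t)
  (F2s : forall n u t n', set_stack (F n u t) 2 (unary n') = F n' u t)
  (FUs : forall n u t u', set_stack (F n u t) U (unary u') = F n u' t)
  (F6s : forall n u t t', set_stack (F n u t) 6 (unary t') = F n u t').

Lemma runs_copy_counter n : runs (copy_counter U) (10 * n + 2) (F n 0 0) (F n n 0).
Proof.
have R1 m t : runs (While 2 isSome (Seq (Pop 2) (Push 6 tick))) (4 * m + 1)
    (F m 0 t) (F 0 0 (t + m)).
  elim: m t => [|m IHm] t; first by rewrite addn0; apply: runs_while_false; rewrite F2.
  have P1 := runs_pop 2 (F m.+1 0 t); rewrite F2 behead_unary F2s in P1.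
  have P2 := runs_push 6 tick (F m 0 t); rewrite F6 cons_unary F6s in P2.
  rewrite -(addSnnS t m); have H := runs_while_true _ (runs_seq P1 P2) (IHm _).
  by apply: runs_leq (H _); [lia|rewrite F2].
suff R2 m u t : runs (While 6 isSome (Seq (Pop 6) (Seq (Push 2 tick) (Push U tick))))
    (6 * t + 1) (F m u t) (F (m + t) (u + t) 0).
  by apply: runs_leq (runs_seq (R1 n 0) (R2 0 0 (0 + n))); lia.
elim: t m u => [|t IHt] m u; first by rewrite !addn0; apply: runs_while_false; rewrite F6.
have P1 := runs_pop 6 (F m u t.+1); rewrite F6 behead_unary F6s in P1.
have P2 := runs_push 2 tick (F m u t); rewrite F2 cons_unary F2s in P2.
have P3 := runs_push U tick (F m.+1 u t); rewrite FU cons_unary FUs in P3.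
rewrite -(addSnnS m t) -(addSnnS u t).
have H := runs_while_true _ (runs_seq P1 (runs_seq P2 P3)) (IHt _ _).
by apply: runs_leq (H _); [lia|rewrite F6].
Qed.

End CopyCounter.

Definition clear (U : nat) : prog letter := While U isSome (Pop U).

Lemma runs_clear U (F : nat -> seq (seq letter)) u :
  (forall u, stack (F u) U = unary u) ->
  (forall u u', set_stack (F u) U (unary u') = F u') ->
  runs (clear U) (2 * u + 1) (F u) (F 0).
Proof.
move=> FU FUs; elim: u => [|u IHu]; first by apply: runs_while_false; rewrite FU.
have P := runs_pop U (F u.+1); rewrite FU behead_unary FUs in P.
by have H := runs_while_true _ P IHu; apply: runs_leq (H _); [lia|rewrite FU].
Qed.

(** Columns credit their cells of colour 1 to stack 7, then rows debit theirs. Popping an empty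
    stack does nothing, so [debit] subtracts with truncation and stack 7 ends empty exactly when
    [C' <= C]. *)
Definition credit : prog letter := While 4 isSome (Seq (Pop 4) (Push 7 tick)).
Definition debit : prog letter := While 4 isSome (Seq (Pop 4) (Pop 7)).

Definition balances (bal : prog letter) (B : nat -> nat -> nat) : Prop :=
  forall i v n x y z t b e l w o,
    runs bal (4 * y + 1) (state i v n x y z t b e l w o)
                         (state i v n x 0 z t (B b y) e l w o).

Lemma runs_credit : balances credit addn.
Proof.
move=> i v n x y z t b e l w o; elim: y b => [|y IHy] b.
  by rewrite addn0; apply: runs_while_false.
have P1 : runs (Pop 4) 1 (state i v n x y.+1 z t b e l w o)
  (state i v n x y z t b e l w o) := runs_pop 4 _.
have P2 : runs (Push 7 tick) 2 (state i v n x y z t b e l w o)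
  (state i v n x y z t b.+1 e l w o) := runs_push 7 tick _.
rewrite -(addSnnS b y); have H := runs_while_true _ (runs_seq P1 P2) (IHy _).
by apply: runs_leq (H _) => //; lia.
Qed.

Lemma runs_debit : balances debit subn.
Proof.
move=> i v n x y z t b e l w o; elim: y b => [|y IHy] b.
  by rewrite subn0; apply: runs_while_false.
have P1 : runs (Pop 4) 1 (state i v n x y.+1 z t b e l w o)
  (state i v n x y z t b e l w o) := runs_pop 4 _.
have P2 : runs (Pop 7) 1 (state i v n x y z t b e l w o)
  (state i v n x y z t b.-1 e l w o) by case: (b) => [|b']; apply: (runs_pop 7).
rewrite -(add1n y) subnDA subn1 add1n; have H := runs_while_true _ (runs_seq P1 P2) (IHy _).
by apply: runs_leq (H _) => //; lia.
Qed.

(** The two counts share one supply of [n] ticks: what is left on stack 5 is the number of empty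
    cells, and an overflow means that the sum exceeds [n]. Colour 1 is read first because the input
    is reversed. *)
Definition process (cs : seq (nat * nat * nat)) (bal : prog letter) : prog letter :=
  Seq (copy_counter 5) (Seq (read_number 4) (Seq (read_number 3)
 (Seq (emit_all cs) (Seq bal (Seq (clear 3) (clear 5)))))).

Lemma runs_process cs bal B p rest n b e l o d :
  balances bal B -> size cs = 6 -> all small_coefs cs ->
  ~~ is_digit (ohead rest) -> n < d ->
  size (bits_of_nat p.1) <= d -> size (bits_of_nat p.2) <= d ->
  exists x y z e',
    [/\ runs (process cs bal) (19 * 1000 * (d * d))
          (state [::] (number_word p.2 ++ number_word p.1 ++ rest) n 0 0 0 0 b e l 0 o)
          (state [::] rest n 0 0 0 0 (B b y) e' l 0
            (encode_nats (map (combination x z y) cs) ++ o)),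
        x + y + z = n,
        e <= e'
      & if p.1 + p.2 <= n then x = p.1 /\ y = p.2 /\ e' = e else e < e'].
Proof.
move=> Bal szcs small nd lt_d sz1 sz2; case: p sz1 sz2 => p1 p2 /= sz1 sz2.
pose V1 := number_word p1 ++ rest; pose V2 := number_word p2 ++ V1.
have R1 := @runs_copy_counter 5 (fun n u t => state [::] V2 n 0 0 u t b e l 0 o)
  (fun _ _ _ => erefl) (fun _ _ _ => erefl) (fun _ _ _ => erefl)
  (fun _ _ _ _ => erefl) (fun _ _ _ _ => erefl) (fun _ _ _ _ => erefl) n.
have [y [z1 [e1 [R2 yz le_e1 val2]]]] :=
  @runs_read_number 4 (fun v u z t e => state [::] v n 0 u z t b e l 0 o)
  (fun _ _ _ _ _ => erefl) (fun _ _ _ _ _ => erefl) (fun _ _ _ _ _ => erefl)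
  (fun _ _ _ _ _ => erefl) (fun _ _ _ _ _ => erefl)
  (fun _ _ _ _ _ _ => erefl) (fun _ _ _ _ _ _ => erefl) (fun _ _ _ _ _ _ => erefl)
  (fun _ _ _ _ _ _ => erefl) (fun _ _ _ _ _ _ => erefl) p2 V1 n e d isT lt_d sz2.
have lt_d1 : z1 < d by lia.
have [x [z [e2 [R3 xz le_e2 val1]]]] :=
  @runs_read_number 3 (fun v u z t e => state [::] v n u y z t b e l 0 o)
  (fun _ _ _ _ _ => erefl) (fun _ _ _ _ _ => erefl) (fun _ _ _ _ _ => erefl)
  (fun _ _ _ _ _ => erefl) (fun _ _ _ _ _ => erefl)
  (fun _ _ _ _ _ _ => erefl) (fun _ _ _ _ _ _ => erefl) (fun _ _ _ _ _ _ => erefl)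
  (fun _ _ _ _ _ _ => erefl) (fun _ _ _ _ _ _ => erefl) p1 rest z1 e1 d nd lt_d1 sz1.
have sum_n : x + y + z = n by lia.
have lt_sum : x + y + z < d by rewrite sum_n.
have R4 := runs_emit_all rest n b e2 l o lt_sum small; rewrite szcs in R4.
set o' := encode_nats _ ++ o in R4.
have R5 := Bal [::] rest n x y z 0 b e2 l 0 o'.
have R6 := @runs_clear 3 (fun u => state [::] rest n u 0 z 0 (B b y) e2 l 0 o') x
  (fun _ => erefl) (fun _ _ => erefl).
have R7 := @runs_clear 5 (fun u => state [::] rest n 0 0 u 0 (B b y) e2 l 0 o') z
  (fun _ => erefl) (fun _ _ => erefl).
exists x, y, z, e2; split=> //; last 1 first.
- by move: val1 val2; do 3!case: ifP => ?; lia.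
- have := runs_seq R1 (runs_seq R2 (runs_seq R3 (runs_seq R4 (runs_seq R5 (runs_seq R6 R7))))).
  apply: runs_leq; have : d <= d * d by nia.
  by lia.
- exact: leq_trans le_e2.
Qed.

Definition pair_entries (ps : seq (nat * nat)) : seq nat :=
  flatten [seq [:: p.1; p.2] | p <- ps].

Definition pairs_word (ps : seq (nat * nat)) : seq letter :=
  rev (encode_nats (pair_entries ps)).

Lemma encode_nats_cat s1 s2 : encode_nats (s1 ++ s2) = encode_nats s1 ++ encode_nats s2.
Proof. by rewrite /encode_nats map_cat flatten_cat. Qed.

Lemma pairs_word_rcons ps p :
  pairs_word (rcons ps p) = number_word p.2 ++ number_word p.1 ++ pairs_word ps.
Proof.
rewrite /pairs_word /pair_entries map_rcons flatten_rcons encode_nats_cat rev_cat catA.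
congr (_ ++ _); rewrite /encode_nats /= cats0 rev_cat !rev_rcons /number_word.
by rewrite !map_rev.
Qed.

Lemma pairs_word_ohead ps : ~~ is_digit (ohead (pairs_word ps)).
Proof. by elim/last_ind: ps => [//|ps p _]; rewrite pairs_word_rcons. Qed.

Definition fits (n : nat) (p : nat * nat) : bool := p.1 + p.2 <= n.

Definition process_all cs bal : prog letter := While 9 isSome (Seq (Pop 9) (process cs bal)).

(** Rows and columns lie on one reversed stack. The columns are consumed first with the rows as the
    rest [qs]; hence the induction from the last pair. *)
Lemma runs_process_all cs bal B ps qs n b e o d :
  balances bal B -> size cs = 6 -> all small_coefs cs -> n < d ->
  (forall p, p \in ps -> size (bits_of_nat p.1) <= d /\ size (bits_of_nat p.2) <= d) ->
  exists b' e' o',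
    [/\ runs (process_all cs bal) (size ps * (20 * 1000 * (d * d)) + 1)
          (state [::] (pairs_word (qs ++ ps)) n 0 0 0 0 b e (size ps) 0 o)
          (state [::] (pairs_word qs) n 0 0 0 0 b' e' 0 0 o'),
        e <= e'
      & if all (fits n) ps then
          [/\ e' = e, b' = foldr (fun p c => B c p.2) b ps
            & o' = encode_nats (flatten
                [seq map (combination p.1 (n - (p.1 + p.2)) p.2) cs | p <- ps]) ++ o]
        else e < e'].
Proof.
move=> Bal szcs small lt_d; elim/last_ind: ps b e o => [|ps p IHps] b e o szb.
  by exists b, e, o; split=> //; rewrite cats0; apply: runs_while_false.
have [sz1 sz2] : size (bits_of_nat p.1) <= d /\ size (bits_of_nat p.2) <= d.
  by apply: szb; rewrite mem_rcons mem_head.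
have [x [y [z [e1 [R1 xyz le_e1 val1]]]]] :=
  @runs_process cs bal B p (pairs_word (qs ++ ps)) n b e (size ps) o d
    Bal szcs small (pairs_word_ohead _) lt_d sz1 sz2.
set o1 := encode_nats _ ++ o in R1.
have szb' q : q \in ps -> size (bits_of_nat q.1) <= d /\ size (bits_of_nat q.2) <= d.
  by move=> qps; apply: szb; rewrite mem_rcons in_cons qps orbT.
have [b' [e' [o' [R2 le_e' val2]]]] := IHps (B b y) e1 o1 szb'.
exists b', e', o'; split; last 1 first.
- rewrite all_rcons {1}/fits; case: (p.1 + p.2 <= n) val1 => [[ex [ey ee]]|lt_e] /=;
    last exact: leq_trans le_e'.
  move: val2; rewrite ee ey; case: ifP => // _ [-> -> ->]; split=> //.
    by rewrite foldr_rcons.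
  rewrite map_rcons flatten_rcons encode_nats_cat -catA /o1 ex ey.
  by rewrite -xyz ex ey addKn.
- rewrite -rcons_cat pairs_word_rcons size_rcons.
  have P : runs (Pop 9) 1
    (state [::] (number_word p.2 ++ number_word p.1 ++ pairs_word (qs ++ ps))
       n 0 0 0 0 b e (size ps).+1 0 o)
    (state [::] (number_word p.2 ++ number_word p.1 ++ pairs_word (qs ++ ps))
       n 0 0 0 0 b e (size ps) 0 o) := runs_pop 9 _.
  have H := runs_while_true _ (runs_seq P R1) R2.
  apply: runs_leq (H _) => //; have : 0 < d * d by nia.
  by lia.
- exact: leq_trans le_e'.
Qed.

(** * Preparing the input and assembling the reduction *)

Definition skip_number : prog letter := Seq (While 0 is_digit (Pop 0)) (Pop 0).

(** A program pushes only constant letters, so each letter is identified by tests. The end markers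
    are counted on stack 6 for [quarter_counter]. *)
Definition reverse_input : prog letter :=
  While 0 isSome
    (Seq (If 0 (fun x => x == Some None) (Seq (Push 1 None) (Push 6 tick))
           (If 0 (is_bit true) (Push 1 (Some true)) (Push 1 (Some false))))
         (Pop 0)).

(* The input holds [4 * n] numbers after [n], which gives [n] in unary. *)
Definition quarter_counter : prog letter :=
  While 6 isSome
    (Seq (Pop 6) (Seq (Pop 6) (Seq (Pop 6) (Seq (Pop 6)
    (Seq (Push 2 tick) (Push 9 tick)))))).

Lemma runs_skip_number m i v n x y z t b e l w o :
  runs skip_number (2 * size (bits_of_nat m) + 2)
    (state (bits_word m ++ None :: i) v n x y z t b e l w o)
    (state i v n x y z t b e l w o).
Proof.
have R2 : runs (Pop 0) 1 (state (None :: i) v n x y z t b e l w o)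
  (state i v n x y z t b e l w o) := runs_pop 0 _.
suff R1 : runs (While 0 is_digit (Pop 0)) (2 * size (bits_of_nat m) + 1)
    (state (bits_word m ++ None :: i) v n x y z t b e l w o)
    (state (None :: i) v n x y z t b e l w o).
  by apply: runs_leq (runs_seq R1 R2); lia.
rewrite /bits_word; elim: (bits_of_nat m) => [|c s IHs] /=; first exact: runs_while_false.
have P : runs (Pop 0) 1 (state (Some c :: map Some s ++ None :: i) v n x y z t b e l w o)
  (state (map Some s ++ None :: i) v n x y z t b e l w o) := runs_pop 0 _.
by have H := runs_while_true _ P IHs; apply: runs_leq (H _) => //; lia.
Qed.

Lemma runs_reverse_input i v n x y z t b e l w o :
  runs reverse_input (7 * size i + 1) (state i v n x y z t b e l w o)
    (state [::] (rev i ++ v) n x y z (t + count_mem None i) b e l w o).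
Proof.
elim: i v t => [|c i IHi] v t; first by rewrite addn0; apply: runs_while_false.
have P : runs (Pop 0) 1
    (state (c :: i) (c :: v) n x y z (t + (c == None)) b e l w o)
    (state i (c :: v) n x y z (t + (c == None)) b e l w o) := runs_pop 0 _.
suff R : runs (If 0 (fun x => x == Some None) (Seq (Push 1 None) (Push 6 tick))
           (If 0 (is_bit true) (Push 1 (Some true)) (Push 1 (Some false)))) 5
    (state (c :: i) v n x y z t b e l w o)
    (state (c :: i) (c :: v) n x y z (t + (c == None)) b e l w o).
  rewrite rev_cons cat_rcons /= addnA.
  have H := runs_while_true _ (runs_seq R P) (IHi _ _).
  by apply: runs_leq (H _) => //; lia.
case: c {P} => [[]|].
- rewrite addn0; apply: (@runs_leq _ _ 4) => //; apply: runs_if_false => //.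
  apply: runs_if_true => //; exact: (runs_push 1 (Some true)).
- rewrite addn0; apply: (@runs_leq _ _ 4) => //; apply: runs_if_false => //.
  apply: runs_if_false => //; exact: (runs_push 1 (Some false)).
- rewrite addn1; apply: runs_if_true => //.
  have P1 : runs (Push 1 None) 2 (state (None :: i) v n x y z t b e l w o)
    (state (None :: i) (None :: v) n x y z t b e l w o) := runs_push 1 None _.
  have P2 : runs (Push 6 tick) 2 (state (None :: i) (None :: v) n x y z t b e l w o)
    (state (None :: i) (None :: v) n x y z t.+1 b e l w o) := runs_push 6 tick _.
  exact: runs_seq P1 P2.
Qed.

Lemma runs_quarter_counter i v n x y z m b e l w o :
  runs quarter_counter (9 * m + 1) (state i v n x y z (4 * m) b e l w o)
    (state i v (n + m) x y z 0 b e (l + m) w o).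
Proof.
elim: m n l => [|m IHm] n l; first by rewrite !addn0; apply: runs_while_false.
have P t : runs (Pop 6) 1 (state i v n x y z t.+1 b e l w o)
  (state i v n x y z t b e l w o) := runs_pop 6 _.
have P5 : runs (Push 2 tick) 2 (state i v n x y z (4 * m) b e l w o)
  (state i v n.+1 x y z (4 * m) b e l w o) := runs_push 2 tick _.
have P6 : runs (Push 9 tick) 2 (state i v n.+1 x y z (4 * m) b e l w o)
  (state i v n.+1 x y z (4 * m) b e l.+1 w o) := runs_push 9 tick _.
have R := runs_seq (P (4 * m).+3) (runs_seq (P _)
  (runs_seq (P _) (runs_seq (P _) (runs_seq P5 P6)))).
rewrite -(addSnnS n m) -(addSnnS l m).
have H := runs_while_true _ R (IHm _ _).
have -> : 4 * m.+1 = (4 * m).+4 by lia.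
by apply: runs_leq (H _) => //; lia.
Qed.

Definition row_coefs : seq (nat * nat * nat) :=
  [:: (0, 2, 1); (3, 0, 2); (0, 2, 1); (0, 0, 0); (0, 0, 0); (0, 0, 0)].
Definition col_coefs : seq (nat * nat * nat) :=
  [:: (1, 0, 1); (0, 2, 0); (1, 0, 2); (0, 2, 0); (1, 0, 1); (0, 0, 0)].

Lemma row_coefsE n a c :
  map (combination a (n - (a + c)) c) row_coefs = row_entries n a c.
Proof. by rewrite /row_entries /combination /= !mul0n !mul1n !addn0 !add0n. Qed.

Lemma col_coefsE n a c :
  map (combination a (n - (a + c)) c) col_coefs = col_entries n a c.
Proof. by rewrite /col_entries /combination /= !mul0n !mul1n !addn0 !add0n. Qed.

(** The 1 by 1 grid with row projection 1 and column projection 0; no square fits into it. *)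
Definition output_no_instance : prog letter :=
  Seq (While 11 isSome (Pop 11))
 (Seq (Push 11 None) (Seq (Push 11 None) (Seq (Push 11 (Some true))
 (Seq (Push 11 None) (Push 11 (Some true)))))).

Definition translate_instance : prog letter :=
  Seq skip_number (Seq reverse_input (Seq quarter_counter
 (Seq (process_all col_coefs credit) (Seq (copy_counter 9)
 (Seq (process_all row_coefs debit)
 (Seq (Push 11 None) (add_multiple 2 6))))))).

Definition reduction : prog letter :=
  Seq translate_instance
      (If 8 isSome output_no_instance (If 7 isSome output_no_instance skip)).

Lemma runs_output_no_instance i v n x y z t b e l w o :
  runs output_no_instance (2 * size o + 11) (state i v n x y z t b e l w o)
    (state i v n x y z t b e l w (encode_nats [:: 1; 1; 0])).
Proof.
have R1 : runs (While 11 isSome (Pop 11)) (2 * size o + 1)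
    (state i v n x y z t b e l w o) (state i v n x y z t b e l w [::]).
  elim: o => [|c o IHo]; first exact: runs_while_false.
  have P : runs (Pop 11) 1 (state i v n x y z t b e l w (c :: o))
    (state i v n x y z t b e l w o) := runs_pop 11 _.
  by have H := runs_while_true _ P IHo; apply: runs_leq (H _) => //; rewrite /=; lia.
have P c o' : runs (Push 11 c) 2 (state i v n x y z t b e l w o')
    (state i v n x y z t b e l w (c :: o')) := runs_push 11 c _.
have := runs_seq R1 (runs_seq (P None [::]) (runs_seq (P None _) (runs_seq (P (Some true) _)
  (runs_seq (P None _) (P (Some true) _))))).
by apply: runs_leq; lia.
Qed.

Lemma count_encode_nats s : count_mem None (encode_nats s) = size s.
Proof.
elim: s => //= m s IHs; rewrite /encode_nats /= count_cat -/(encode_nats s) IHs.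
rewrite -cats1 count_cat /= count_map (eq_count (a2 := pred0)) ?count_pred0 //.
Qed.

Lemma size_bits_encode_nats m s : m \in s -> size (bits_of_nat m) < size (encode_nats s).
Proof.
elim: s => //= k s IHs; rewrite in_cons /encode_nats /= size_cat -/(encode_nats s).
rewrite size_rcons size_map => /orP[/eqP->|/IHs h]; first by rewrite addSn ltnS leq_addr.
exact: leq_trans h (leq_addl _ _).
Qed.

Lemma size_pair_entries ps : size (pair_entries ps) = 2 * size ps.
Proof.
elim: ps => //= p ps IHps; rewrite /pair_entries /= -/(pair_entries ps) IHps.
by rewrite mulnS.
Qed.

Lemma mem_pair_entries ps p : p \in ps -> (p.1 \in pair_entries ps) && (p.2 \in pair_entries ps).
Proof.
elim: ps => //= q ps IHps; rewrite in_cons /pair_entries /= !in_cons -/(pair_entries ps).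
by case/orP=> [/eqP->|/IHps/andP[-> ->]]; rewrite ?eqxx ?orbT.
Qed.

Lemma foldr_credit b (ps : seq (nat * nat)) :
  foldr (fun p c => c + p.2) b ps = b + sumn (map snd ps).
Proof. by elim: ps => [|p ps IHps] /=; rewrite ?addn0 // IHps [_ + p.2]addnC addnCA. Qed.

Lemma foldr_debit b (ps : seq (nat * nat)) :
  foldr (fun p c => c - p.2) b ps = b - sumn (map snd ps).
Proof. by elim: ps => [|p ps IHps] /=; rewrite ?subn0 // IHps subnDA subnAC. Qed.

Definition translatable (n : nat) (rp cp : seq (nat * nat)) : bool :=
  all (fits n) (rp ++ cp) && (sumn (map snd cp) <= sumn (map snd rp)).

Definition translated_entries (n : nat) (rp cp : seq (nat * nat)) : seq nat :=
  flatten [seq row_entries n p.1 p.2 | p <- rp] ++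
  flatten [seq col_entries n p.1 p.2 | p <- cp].

Lemma runs_translate_instance n rp cp :
  size rp = n -> size cp = n ->
  let i := encode_nats (n :: pair_entries rp ++ pair_entries cp) in
  let d := (size i).+1 in
  exists b e o,
    runs translate_instance (41 * 1000 * (d * (d * d)))
      (state i [::] 0 0 0 0 0 0 0 0 0 [::]) (state [::] [::] n 0 0 0 0 b e 0 0 o) /\
    if translatable n rp cp then
      [/\ e = 0, b = 0 & o = encode_nats (n * 6 :: translated_entries n rp cp)]
    else 0 < e + b.
Proof.
move=> szr szc i d.
pose i1 := encode_nats (pair_entries (rp ++ cp)).
have iE : i = bits_word n ++ None :: i1.
  rewrite /i -[encode_nats _]cats0 encode_nats_cons cats0 /i1.
  by rewrite /pair_entries map_cat flatten_cat.
have szi : size i = (size (bits_of_nat n) + size i1).+1.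
  by rewrite iE size_cat /= size_map; lia.
have cnt : count_mem None i1 = 4 * n.
  by rewrite count_encode_nats size_pair_entries size_cat; lia.
have le_n : 4 * n <= size i1 by rewrite -cnt; exact: count_size.
have lt_n : n < d by rewrite /d szi; lia.
have R1 := runs_skip_number n i1 [::] 0 0 0 0 0 0 0 0 0 [::].
have R2 := runs_reverse_input i1 [::] 0 0 0 0 0 0 0 0 0 [::].
rewrite cats0 -/(pairs_word (rp ++ cp)) cnt add0n in R2.
have R3 := runs_quarter_counter [::] (pairs_word (rp ++ cp)) 0 0 0 0 n 0 0 0 0 [::].
rewrite !add0n in R3.
have szb p : p \in rp ++ cp -> size (bits_of_nat p.1) <= d /\ size (bits_of_nat p.2) <= d.
  move=> /mem_pair_entries/andP[/size_bits_encode_nats h1 /size_bits_encode_nats h2].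
  by rewrite /d szi -/i1 in h1 h2 *; lia.
have szc' p : p \in cp -> size (bits_of_nat p.1) <= d /\ size (bits_of_nat p.2) <= d.
  by move=> pcp; apply: szb; rewrite mem_cat pcp orbT.
have szr' p : p \in rp -> size (bits_of_nat p.1) <= d /\ size (bits_of_nat p.2) <= d.
  by move=> prp; apply: szb; rewrite mem_cat prp.
have [b1 [e1 [o1 [R4 _ val1]]]] := @runs_process_all col_coefs credit addn cp rp n 0 0 [::] d
  runs_credit erefl isT lt_n szc'.
have R5 := @runs_copy_counter 9 (fun n u t => state [::] (pairs_word rp) n 0 0 0 t b1 e1 u 0 o1)
  (fun _ _ _ => erefl) (fun _ _ _ => erefl) (fun _ _ _ => erefl)
  (fun _ _ _ _ => erefl) (fun _ _ _ _ => erefl) (fun _ _ _ _ => erefl) n.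
have [b2 [e2 [o2 [R6 le_e2 val2]]]] := @runs_process_all row_coefs debit subn rp [::] n b1 e1 o1 d
  runs_debit erefl isT lt_n szr'.
have R7 : runs (Push 11 None) 2 (state [::] [::] n 0 0 0 0 b2 e2 0 0 o2)
  (state [::] [::] n 0 0 0 0 b2 e2 0 0 (None :: o2)) := runs_push 11 None _.
have R8 := @runs_add_multiple 2 (fun u t w o => state [::] [::] u 0 0 0 t b2 e2 0 w o)
  (fun _ _ _ _ => erefl) (fun _ _ _ _ => erefl) (fun _ _ _ _ => erefl) (fun _ _ _ _ => erefl)
  (fun _ _ _ _ _ => erefl) (fun _ _ _ _ _ => erefl) (fun _ _ _ _ _ => erefl)
  (fun _ _ _ _ _ => erefl) 6 n 0 o2 (6 * n) (leqnn _).
rewrite szc in R4; rewrite szr cat0s in R6; rewrite add0n in R8.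
exists b2, e2, (bits_word (6 * n) ++ None :: o2); split.
  rewrite iE; have := runs_seq R1 (runs_seq R2 (runs_seq R3 (runs_seq R4 (runs_seq R5
    (runs_seq R6 (runs_seq R7 R8)))))).
  apply: runs_leq.
  have d1 : 0 < d by [].
  have d2 : d <= d * d by rewrite leq_pmulr.
  have d3 : d * d <= d * (d * d) by rewrite leq_pmull.
  (* The two [process_all] loops account for 40 of the 41 thousand; everything else is at most
     quadratic. *)
  have m1 : n * (20 * 1000 * (d * d)) <= 20 * 1000 * (d * (d * d)).
    by rewrite mulnCA leq_mul2l leq_mul2r (ltnW lt_n) !orbT.
  have m2 : n * (6 * (8 * (6 * n) + 8) + 9) <= d * (345 * d) by apply: leq_mul; lia.
  have m3 : d * (345 * d) = 345 * (d * d) by rewrite mulnCA.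
  by move: m1 m2 d2 d3; rewrite m3; move: szi; rewrite -[size i]/(d.-1); lia.
rewrite /translatable all_cat.
move: val1 val2; case: (all (fits n) cp) => [[-> -> ->]|]; last first.
  by rewrite andbF /= => lt_e1 _; lia.
case: (all (fits n) rp) => [[-> -> ->]|] /=; last by lia.
rewrite foldr_credit foldr_debit add0n; case: ifP => [le_s|gt_s]; last by lia.
split=> //; first by lia.
rewrite -[RHS]cats0 encode_nats_cons mulnC cats0 /translated_entries encode_nats_cat cats0.
by congr (_ ++ _ :: encode_nats (flatten _) ++ encode_nats (flatten _));
  apply: eq_map => p; [exact: row_coefsE|exact: col_coefsE].
Qed.

Lemma runs_reduction n rp cp :
  size rp = n -> size cp = n ->
  let i := encode_nats (n :: pair_entries rp ++ pair_entries cp) in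
  let d := (size i).+1 in
  exists2 s, runs reduction (130 * 1000 * (d * (d * d))) (i :: nseq 11 [::]) s &
    stack s 11 = encode_nats (if translatable n rp cp
                              then n * 6 :: translated_entries n rp cp else [:: 1; 1; 0]).
Proof.
move=> szr szc i d.
have [b [e [o [[t le_t E] val]]]] := runs_translate_instance szr szc.
rewrite -/i -/d in le_t E.
(* Erasing the output costs about twice its length, so about three times the 41 thousand in all,
   rounded up to 130. *)
have le_o : size o <= d + t.
  have := size_stack_le (state [::] [::] n 0 0 0 0 b e 0 0 o) 11.
  by have := exec_total_size E; rewrite /total_size /= /d; lia.
have R1 : runs translate_instance t (i :: nseq 11 [::]) (state [::] [::] n 0 0 0 0 b e 0 0 o).
  by exists t.
have R2 := runs_output_no_instance [::] [::] n 0 0 0 0 b e 0 0 o.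
have le_d : d <= d * (d * d) by rewrite leq_pmulr // muln_gt0.
have d0 : 0 < d by [].
case: (translatable n rp cp) val => [[e0 b0 oE]|eb].
  exists (state [::] [::] n 0 0 0 0 b e 0 0 o); last by rewrite -oE.
  have R3 : runs (If 8 isSome output_no_instance (If 7 isSome output_no_instance skip)) 3
      (state [::] [::] n 0 0 0 0 b e 0 0 o) (state [::] [::] n 0 0 0 0 b e 0 0 o).
    by rewrite e0 b0; apply: runs_if_false => //; apply: runs_if_false => //; apply: runs_skip.
  by apply: runs_leq (runs_seq R1 R3); lia.
exists (state [::] [::] n 0 0 0 0 b e 0 0 (encode_nats [:: 1; 1; 0])) => //.
have R3 : runs (If 8 isSome output_no_instance (If 7 isSome output_no_instance skip))
    (2 * size o + 13) (state [::] [::] n 0 0 0 0 b e 0 0 o)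
    (state [::] [::] n 0 0 0 0 b e 0 0 (encode_nats [:: 1; 1; 0])).
  rewrite addnS; case: e {E R1} eb R2 => [|e] eb R2.
    apply: runs_if_false => //; rewrite addnS; case: b eb R2 => // b _ R2.
    exact: runs_if_true.
  by apply: runs_if_true => //; apply: runs_leq R2; lia.
by apply: runs_leq (runs_seq R1 R3); lia.
Qed.

(** * Correctness of the reduction *)

Lemma enum_ord1 : enum 'I_1 = [:: ord0].
Proof. by apply: (inj_map val_inj); rewrite val_enum_ord. Qed.

Lemma enum_ord2 : enum 'I_2 = [:: ord0; ord_max].
Proof. by apply: (inj_map val_inj); rewrite val_enum_ord. Qed.

Definition entry_fun (n h : nat) (B : 'M[nat]_(n, h)) (k : 'I_h) : nat -> nat :=
  restrict_fun 0 (fun i => B i k).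

Definition matrix_pairs (n : nat) (B : 'M[nat]_(n, 2)) : seq (nat * nat) :=
  [seq (entry_fun B ord0 i, entry_fun B ord_max i) | i <- iota 0 n].

Lemma entries_pairs n (B : 'M[nat]_(n, 2)) : entries B = pair_entries (matrix_pairs B).
Proof.
rewrite /entries /pair_entries /matrix_pairs -val_enum_ord -!map_comp enum_ord2.
by congr flatten; apply: eq_map => i /=; rewrite /entry_fun !restrict_fun_ord.
Qed.

Lemma size_matrix_pairs n (B : 'M[nat]_(n, 2)) : size (matrix_pairs B) = n.
Proof. by rewrite size_map size_iota. Qed.

Lemma all_fits_pairs n (B : 'M[nat]_(n, 2)) :
  reflect (forall i, i < n -> entry_fun B ord0 i + entry_fun B ord_max i <= n)
          (all (fits n) (matrix_pairs B)).
Proof.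
rewrite all_map; apply: (iffP allP) => H i; first by move=> li; apply: H; rewrite mem_iota.
by rewrite mem_iota; apply: H.
Qed.

Lemma sumn_pairs n (B : 'M[nat]_(n, 2)) :
  sumn (map snd (matrix_pairs B)) = \sum_(i < n) entry_fun B ord_max i.
Proof. by rewrite sumnE !big_map -[n in iota 0 n]subn0 big_mkord. Qed.

Definition column_of_seq (N : nat) (s : seq nat) : 'M[nat]_(N, 1) := \matrix_(u, k) nth 0 s u.

Lemma entries_column_of_seq N s : size s = N -> entries (column_of_seq N s) = s.
Proof.
move=> sz; rewrite /entries enum_ord1 /=.
have -> : [seq [seq column_of_seq N s i k | k <- [:: ord0]] | i <- enum 'I_N] =
    [seq [:: nth 0 s u] | u <- map val (enum 'I_N)].
  by rewrite -map_comp; apply: eq_map => u /=; rewrite mxE.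
rewrite val_enum_ord -{2}(mkseq_nth 0 s) sz /mkseq.
by elim: (iota 0 N) => //= u l ->.
Qed.

Lemma size_flatten_blocks (T : Type) (E : T -> seq nat) l :
  (forall p, size (E p) = 6) -> size (flatten (map E l)) = size l * 6.
Proof. by move=> szE; elim: l => //= p l IHl; rewrite size_cat szE IHl mulSn. Qed.

Lemma nth_flatten_blocks (T : Type) (E : T -> seq nat) (x0 : T) l i p :
  (forall p, size (E p) = 6) -> i < size l -> p < 6 ->
  nth 0 (flatten (map E l)) (i * 6 + p) = nth 0 (E (nth x0 l i)) p.
Proof.
move=> szE; elim: l i => //= q l IHl [|i] li lp; first by rewrite nth_cat szE add0n lp.
by rewrite mulSn -addnA nth_cat szE ltnNge leq_addr /= addKn IHl.
Qed.

Definition reduce (x : projections 2) : projections 1 :=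
  let n := grid_size x in
  let rp := matrix_pairs (proj_rows x) in
  let cp := matrix_pairs (proj_cols x) in
  if translatable n rp cp then
    Projections
      (column_of_seq (n * 6) (flatten [seq row_entries n p.1 p.2 | p <- rp]))
      (column_of_seq (n * 6) (flatten [seq col_entries n p.1 p.2 | p <- cp]))
  else Projections (column_of_seq 1 [:: 1]) (column_of_seq 1 [:: 0]).

Lemma encode_reduce x :
  let n := grid_size x in
  let rp := matrix_pairs (proj_rows x) in
  let cp := matrix_pairs (proj_cols x) in
  encode_projections (reduce x) =
  encode_nats (if translatable n rp cp
               then n * 6 :: translated_entries n rp cp else [:: 1; 1; 0]).
Proof.
move=> n rp cp; rewrite /reduce /encode_projections -/n -/rp -/cp.
case: ifP => _ /=; rewrite !entries_column_of_seq //.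
all: by rewrite size_flatten_blocks // size_matrix_pairs.
Qed.

Section ReduceCorrect.
Variable x : projections 2.
Local Notation n := (grid_size x).
Local Notation a := (entry_fun (proj_rows x) ord0).
Local Notation c := (entry_fun (proj_rows x) ord_max).
Local Notation a' := (entry_fun (proj_cols x) ord0).
Local Notation c' := (entry_fun (proj_cols x) ord_max).

Lemma two_atom_colouring :
  consistent [tuple atom; atom] x <-> exists g, colouring_with n a c a' c' g.
Proof.
apply: (iff_trans (two_atom_consistentP x)); split=> -[g [rg cg]]; exists g.
  split=> i li; pose i' := Ordinal li; rewrite /colour_count.
    by rewrite -[i]/(val i') /entry_fun !restrict_fun_ord -!rg.
  by rewrite -[i]/(val i') /entry_fun !restrict_fun_ord -!cg.
split=> i k; have [->|->] : k = ord0 \/ k = ord_max.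
- by case: k => -[|[|]] // lt; [left|right]; apply: val_inj.
- by have [e _] := rg i (ltn_ord i); rewrite [LHS]e /entry_fun restrict_fun_ord.
- by have [_ e] := rg i (ltn_ord i); rewrite [LHS]e /entry_fun restrict_fun_ord.
- by case: k => -[|[|]] // lt; [left|right]; apply: val_inj.
- by have [e _] := cg i (ltn_ord i); rewrite [LHS]e /entry_fun restrict_fun_ord.
- by have [_ e] := cg i (ltn_ord i); rewrite [LHS]e /entry_fun restrict_fun_ord.
Qed.

Lemma nth_pairs (B : 'M[nat]_(n, 2)) i : i < n ->
  nth (0, 0) (matrix_pairs B) i = (entry_fun B ord0 i, entry_fun B ord_max i).
Proof. by move=> li; rewrite (nth_map 0) ?size_iota // nth_iota. Qed.

Lemma square_packing_with :
  translatable n (matrix_pairs (proj_rows x)) (matrix_pairs (proj_cols x)) ->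
  consistent [tuple square] (reduce x) <-> exists S, packing_with n a c a' c' S.
Proof.
rewrite /reduce => ->; apply: (iff_trans (square_consistentP _)) => /=.
have blockE (E : nat * nat -> seq nat) (B : 'M[nat]_(n, 2)) i p :
    (forall p, size (E p) = 6) -> i < n -> p < 6 ->
    nth 0 (flatten (map E (matrix_pairs B))) (i * 6 + p) =
    nth 0 (E (entry_fun B ord0 i, entry_fun B ord_max i)) p.
  by move=> szE li lp; rewrite (nth_flatten_blocks (0, 0)) ?size_matrix_pairs // nth_pairs.
split=> -[S [pS RS CS]]; exists S; split=> //.
- move=> i p li lp; have lu : i * 6 + p < n * 6 by lia.
  by have := RS (Ordinal lu); rewrite mxE /= => ->; rewrite blockE.
- move=> j q lj lq; have lv : j * 6 + q < n * 6 by lia.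
  by have := CS (Ordinal lv); rewrite mxE /= => ->; rewrite blockE.
- move=> u; rewrite mxE; have lu : u %/ 6 < n by rewrite ltn_divLR.
  by rewrite (divn_eq u 6) blockE ?ltn_pmod // RS ?ltn_pmod.
- move=> v; rewrite mxE; have lv : v %/ 6 < n by rewrite ltn_divLR.
  by rewrite (divn_eq v 6) blockE ?ltn_pmod // CS ?ltn_pmod.
Qed.

(** Double counting the cells of colour 1 gives equal totals, so the one-sided test never rejects a
    consistent instance. *)
Lemma colouring_translatable g : colouring_with n a c a' c' g ->
  translatable n (matrix_pairs (proj_rows x)) (matrix_pairs (proj_cols x)).
Proof.
move=> [rg cg]; rewrite /translatable all_cat !sumn_pairs; apply/andP; split.
  apply/andP; split; apply/all_fits_pairs => i li.
    by have [<- <-] := rg i li; apply: colour_count_le.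
  by have [<- <-] := cg i li; apply: colour_count_le.
have -> : \sum_(j < n) c' j = \sum_(j < n) \sum_(i < n) (g i j == 1).
  by apply: eq_bigr => j _; have [_ <-] := cg j (ltn_ord j).
rewrite exchange_big; apply: eq_leq; apply: eq_bigr => i _.
by have [_ <-] := rg i (ltn_ord i).
Qed.

Lemma reduce_correct : consistent [tuple square] (reduce x) <-> consistent [tuple atom; atom] x.
Proof.
case: (boolP (translatable n (matrix_pairs (proj_rows x))
  (matrix_pairs (proj_cols x)))) => [tr|ntr].
  apply: (iff_trans (square_packing_with tr)).
  apply: (iff_trans _ (iff_sym two_atom_colouring)); split=> [[S pS]|[g cg]].
    move: tr; rewrite /translatable all_cat !sumn_pairs.
    move=> /andP[/andP[/all_fits_pairs rle /all_fits_pairs cle] le].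
    by eexists; apply: packing_colouring rle cle le pS.
  by eexists; apply: colouring_packing cg.
split=> [|/two_atom_colouring[g /colouring_translatable]]; last by rewrite (negPf ntr).
rewrite /reduce (negPf ntr) => /square_consistentP/= [S [[inS _] RS _]].
(* The row projection 1 forces a corner at the only cell, and its square leaves the grid. *)
have := RS ord0; rewrite mxE big_ord_recr big_ord0 /=.
by case S00 : (S 0 0) => // _; have [] := inS _ _ S00.
Qed.

End ReduceCorrect.

Theorem theorem4 :
  solvable_in_polynomial_time square_consistency ->
  solvable_in_polynomial_time two_atom_consistency.
Proof.
pose D : {poly nat} := ('X + 1%:P)%R.
(* The value 10 of [k] gives the twelve stacks of [state], with the output on stack 11; [D]
   evaluates to the [d] of [runs_reduction]. *)
apply: (@polynomial_time_reduction _ two_atom_consistency square_consistency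
  reduce reduction 10 (130%:P * 1000%:P * (D * (D * D)))%R).
- by [].
- exact: reduce_correct.
move=> x; have [s [t le_t E] sO] :=
  runs_reduction (size_matrix_pairs (proj_rows x)) (size_matrix_pairs (proj_cols x)).
exists t, s; split.
- rewrite /= /encode_projections !entries_pairs.
  rewrite !hornerM !hornerC !hornerD hornerX hornerC.
  by move: le_t; set m := size _; rewrite -(addn1 m).
- by rewrite /= /encode_projections !entries_pairs.
- by rewrite sO /= encode_reduce.
Qed.
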